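(* Let $d\ge1$. For all real numbers $\alpha,t$ with $0\le\alpha\le d$ and $0\le t\le d$, there are a decreasing sequence $(l_n)_{n\ge1}$ of positive reals with $\alpha(l_n)=\alpha$ and a closed set $F\subset\mathbb{T}^d$ with $\dim_H(F)=t$ and $\dim_P(F)=d$ such that, if $(\xi_n)_{n\ge1}$ are independent random variables uniformly distributed on $\mathbb{T}^d$ and $E=\limsup_{n\to\infty}B(\xi_n,l_n/2)$ is the associated random covering set, then almost surely $\dim_H(E\cap F)=\min\{\alpha,t\}$. In particular, there exist such $(l_n)$ and closed $F$ for which, with $\alpha=\alpha(l_n)$, almost surely $$\dim_H(F)+\alpha-d<\dim_H(E\cap F)<\dim_P(F)+\alpha-d.$$
   Context: $\mathbb{T}^d$ is the $d$-dimensional torus with its usual (quotient Euclidean) metric and Lebesgue probability measure. $B(x,r)$ is the closed ball of centre $x$ and radius $r$ in $\mathbb{T}^d$. ''Decreasing'' means non-increasing. The random covering set is $E=\limsup_{n\to\infty}B(\xi_n,l_n/2)=\bigcap_{n=1}^\infty\bigcup_{k=n}^\infty B(\xi_k,l_k/2)$. The exponent is $\alpha(l_n)=\sup\{0\le s\le d:\sum_{n=1}^\infty l_n^s=\infty\}$. $\dim_H$ and $\dim_P$ denote Hausdorff and packing dimension, with the convention that the empty set has dimension $0$. *)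

(* Defs.v *)
From HB Require Import structures.
From mathcomp Require Import all_boot all_order all_algebra finmap.
From mathcomp Require Import all_classical all_reals all_analysis.
From mathcomp Require Import ring lra.

Set Implicit Arguments.
Unset Strict Implicit.
Unset Printing Implicit Defensive.

Import Order.TTheory GRing.Theory Num.Theory.
Import numFieldNormedType.Exports.

Local Open Scope classical_set_scope.
Local Open Scope ring_scope.

Section euclidean_norm.
Context {R : realType} {n : nat}.
Implicit Types u v : 'I_n -> R.

Definition enorm u : R := Num.sqrt (\sum_(i < n) u i ^+ 2).

Lemma sum_sqr_ge0 u : 0 <= \sum_(i < n) u i ^+ 2.
Proof. by apply: sumr_ge0 => i _; exact: sqr_ge0. Qed.

Lemma enorm_ge0 u : 0 <= enorm u.
Proof. exact: sqrtr_ge0. Qed.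

Lemma enorm_sqr u : enorm u ^+ 2 = \sum_(i < n) u i ^+ 2.
Proof. by rewrite sqr_sqrtr// sum_sqr_ge0. Qed.

Lemma ler_norm_enorm u i : `|u i| <= enorm u.
Proof.
rewrite -sqrtr_sqr ler_sqrt ?sum_sqr_ge0// (bigD1 i)//= lerDl.
by apply: sumr_ge0 => j _; exact: sqr_ge0.
Qed.

Lemma enormN u : enorm (fun i => - u i) = enorm u.
Proof. by rewrite /enorm; under eq_bigr do rewrite sqrrN. Qed.

Lemma enorm0 : enorm (fun=> 0) = 0.
Proof. by rewrite /enorm big1 ?sqrtr0// => i _; rewrite expr0n. Qed.

Lemma enorm_CS u v : \sum_(i < n) u i * v i <= enorm u * enorm v.
Proof.
have [a0|a0] := eqVneq (enorm u) 0.
  rewrite a0 mul0r big1// => i _.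
  have /= := ler_norm_enorm u i.
  by rewrite a0 normr_le0 => /eqP ->; rewrite mul0r.
have [b0|b0] := eqVneq (enorm v) 0.
  rewrite b0 mulr0 big1// => i _.
  have /= := ler_norm_enorm v i.
  by rewrite b0 normr_le0 => /eqP ->; rewrite mulr0.
have a_gt0 : 0 < enorm u by rewrite lt0r a0 enorm_ge0.
have b_gt0 : 0 < enorm v by rewrite lt0r b0 enorm_ge0.
set a := enorm u in a_gt0 *; set b := enorm v in b_gt0 *.
have : 0 <= \sum_(i < n) (b * u i - a * v i) ^+ 2.
  by apply: sumr_ge0 => i _; exact: sqr_ge0.
have -> : \sum_(i < n) (b * u i - a * v i) ^+ 2 =
    b ^+ 2 * a ^+ 2 + a ^+ 2 * b ^+ 2 - 2 * a * b * \sum_(i < n) u i * v i.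
  rewrite [in X in X + _ - _](enorm_sqr u) [in X in _ + X - _](enorm_sqr v).
  rewrite !mulr_sumr -big_split -sumrB; apply: eq_bigr => i _ /=.
  ring.
move=> h.
rewrite -subr_ge0 -(@pmulr_rge0 _ (2 * a * b)) ?mulr_gt0//.
by apply: le_trans h _; rewrite le_eqVlt; apply/orP; left; apply/eqP; ring.
Qed.

Lemma enorm_triangle u v : enorm (fun i => u i + v i) <= enorm u + enorm v.
Proof.
rewrite -(@ler_pXn2r _ 2%N)// ?nnegrE ?addr_ge0 ?enorm_ge0//.
have -> : enorm (fun i => u i + v i) ^+ 2 =
    enorm u ^+ 2 + enorm v ^+ 2 + 2 * \sum_(i < n) u i * v i.
  rewrite !enorm_sqr mulr_sumr -!big_split; apply: eq_bigr => i _ /=.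
  ring.
have := enorm_CS u v; lra.
Qed.

Lemma enorm_le_sum u : enorm u <= \sum_(i < n) `|u i|.
Proof.
have s0 : 0 <= \sum_(i < n) `|u i| by apply: sumr_ge0.
rewrite -[leRHS](ger0_norm s0) -sqrtr_sqr ler_sqrt ?sqr_ge0//.
rewrite [leRHS]expr2 mulr_sumr; apply: ler_sum => i _.
rewrite -real_normK ?num_real// expr2 ler_wpM2r// (bigD1 i)//= lerDl.
by apply: sumr_ge0.
Qed.

End euclidean_norm.

(* R^d / Z^d, each class being given by its representative in [0, 1[^d. *)

Record torus (R : realType) (d : nat) := Torus {
  torus_val : d.-tuple R ;
  _ : [forall i, 0 <= tnth torus_val i < 1] }.

HB.instance Definition _ (R : realType) (d : nat) :=
  [isSub for @torus_val R d].
HB.instance Definition _ (R : realType) (d : nat) :=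
  [Choice of torus R d by <:].

Section torus_projection.
Context {R : realType} {d : nat}.

Lemma frac_subproof (x : d.-tuple R) :
  [forall i, 0 <= tnth [tuple tnth x j - (Num.floor (tnth x j))%:~R | j < d] i
             < 1].
Proof.
apply/forallP => i; rewrite tnth_mktuple subr_ge0 floor_le/=.
by rewrite ltrBlDl -(intrD1 (Num.floor _)) floorD1_gt.
Qed.

Definition torus_proj (x : d.-tuple R) : torus R d := Torus (frac_subproof x).

End torus_projection.

HB.instance Definition _ (R : realType) (d : nat) :=
  isPointed.Build (torus R d) (torus_proj [tuple 0 | _ < d]).

Definition tcoord (R : realType) (d : nat) (x : torus R d) (i : 'I_d) : R :=
  tnth (torus_val x) i.

(* quotient Euclidean metric: inf over k in Z^d of |x - y + k| *)
Definition torus_dist (R : realType) (d : nat) (x y : torus R d) : R :=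
  inf [set enorm (fun i => tcoord x i - tcoord y i + (k i)%:~R)
      | k in [set: 'I_d -> int]].

Section torus_metric.
Context {R : realType} {d : nat}.
Implicit Types x y z : torus R d.

Lemma tcoord_itv x i : 0 <= tcoord x i < 1.
Proof. by case: x => v p; exact: (forallP p i). Qed.

Lemma tcoord_inj x y : tcoord x =1 tcoord y -> x = y.
Proof. by move=> xy; apply/val_inj/eq_from_tnth. Qed.

Lemma tcoord_proj (x : d.-tuple R) i :
  tcoord (torus_proj x) i = tnth x i - (Num.floor (tnth x i))%:~R.
Proof. by rewrite /tcoord tnth_mktuple. Qed.

Lemma torus_dist_le x y (k : 'I_d -> int) :
  torus_dist x y <= enorm (fun i => tcoord x i - tcoord y i + (k i)%:~R).
Proof.
apply: ge_inf; last by exists k.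
by exists 0 => _ [m _ <-]; exact: enorm_ge0.
Qed.

Lemma torus_dist_has_inf x y :
  has_inf [set enorm (fun i => tcoord x i - tcoord y i + (k i)%:~R)
          | k in [set: 'I_d -> int]].
Proof.
split; first by eexists; exists (fun=> 0).
by exists 0 => _ [m _ <-]; exact: enorm_ge0.
Qed.

Lemma torus_dist_adherent x y e : 0 < e -> exists k : 'I_d -> int,
  enorm (fun i => tcoord x i - tcoord y i + (k i)%:~R) < torus_dist x y + e.
Proof.
move=> e0; have [_ [k _ <-] kxy] := inf_adherent e0 (torus_dist_has_inf x y).
by exists k.
Qed.

Lemma torus_dist_ge0 x y : 0 <= torus_dist x y.
Proof.
apply: lb_le_inf; first by case: (torus_dist_has_inf x y).
by move=> _ [m _ <-]; exact: enorm_ge0.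
Qed.

Lemma torus_distxx x : torus_dist x x = 0.
Proof.
apply/eqP; rewrite eq_le torus_dist_ge0 andbT.
apply: (le_trans (torus_dist_le x x (fun=> 0))).
by rewrite (_ : (fun _ => _) = fun=> 0) ?enorm0//; apply/funext => i; rewrite subrr addr0.
Qed.

Lemma torus_dist_positivity x y : torus_dist x y = 0 -> x = y.
Proof.
move=> xy0; apply: tcoord_inj => i; apply/eqP; apply: contraT => xyi.
have /andP[x0 x1] := tcoord_itv x i; have /andP[y0 y1] := tcoord_itv y i.
set t := `|tcoord x i - tcoord y i|.
have t0 : 0 < t by rewrite normr_gt0 subr_eq0.
have t1 : t < 1 by rewrite ltr_norml; apply/andP; split; lra.
have e0 : 0 < Num.min t (1 - t) by rewrite lt_min t0 subr_gt0.
have [k] := torus_dist_adherent x y e0.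
rewrite xy0 add0r ltNge => /negP[].
apply: le_trans (ler_norm_enorm _ i); rewrite /= ge_min.
have [->|k0] := eqVneq (k i) 0; first by rewrite addr0 lexx.
apply/orP; right.
have k1 : 1 <= `|(k i)%:~R : R|.
  by rewrite -intr_norm ler1z -gtz0_ge1 normr_gt0.
have := ler_normB (tcoord x i - tcoord y i + (k i)%:~R)
  (tcoord x i - tcoord y i).
rewrite addrAC subrr add0r -/t; lra.
Qed.

Lemma torus_dist_sym_le x y : torus_dist x y <= torus_dist y x.
Proof.
apply/ler_addgt0Pl => e e0; rewrite addrC.
have [k /ltW/(le_trans _)] := torus_dist_adherent y x e0; apply.
apply: le_trans (torus_dist_le x y (fun i => - k i)) _.
rewrite -enormN le_eqVlt; apply/orP; left; apply/eqP; congr enorm.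
by apply/funext => i; rewrite mulrNz; ring.
Qed.

Lemma torus_dist_sym x y : torus_dist x y = torus_dist y x.
Proof. by apply/eqP; rewrite eq_le !torus_dist_sym_le. Qed.

Lemma torus_dist_triangle y x z :
  torus_dist x z <= torus_dist x y + torus_dist y z.
Proof.
apply/ler_addgt0Pl => e e0.
have e20 : 0 < e / 2 by rewrite divr_gt0.
have [k kxy] := torus_dist_adherent x y e20.
have [m myz] := torus_dist_adherent y z e20.
apply: le_trans (torus_dist_le x z (fun i => k i + m i)) _.
have := enorm_triangle (fun i => tcoord x i - tcoord y i + (k i)%:~R)
  (fun i => tcoord y i - tcoord z i + (m i)%:~R).
rewrite (_ : (fun i => _ + _) =
  (fun i => tcoord x i - tcoord z i + (k i + m i)%:~R)); first lra.
by apply/funext => i; rewrite intrD; ring.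
Qed.

Lemma torus_dist_proj_le (x y : d.-tuple R) :
  torus_dist (torus_proj x) (torus_proj y) <=
  \sum_(i < d) `|tnth x i - tnth y i|.
Proof.
apply: le_trans (enorm_le_sum (fun i => tnth x i - tnth y i)).
apply: le_trans (torus_dist_le _ _
  (fun i => Num.floor (tnth x i) - Num.floor (tnth y i))) _.
rewrite le_eqVlt; apply/orP; left; apply/eqP; congr enorm; apply/funext => i.
by rewrite !tcoord_proj intrB; ring.
Qed.

End torus_metric.

HB.instance Definition _ (R : realType) (d : nat) :=
  @isMetric.Build R (torus R d) (@torus_dist R d) torus_distxx
    torus_dist_positivity torus_dist_sym torus_dist_triangle.

HB.instance Definition _ (R : realType) (d : nat) := @isMeasurable.Build
  (sigma_display (@open (torus R d))) (torus R d) <<s @open (torus R d) >>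
  (@sigma_algebra0 _ setT _) (@sigma_algebraC _ _)
  (@sigma_algebra_bigcup _ setT _).

Section lebesgue_torus.
Context {R : realType}.

Definition cons_pair n (p : measurableTypeR R * n.-tuple R) : n.+1.-tuple R :=
  [tuple of (p.1 : R) :: p.2].

Lemma measurable_cons_pair n : measurable_fun setT (@cons_pair n).
Proof. by apply: measurable_cons; [exact: measurable_fst|exact: measurable_snd]. Qed.

HB.instance Definition _ n := isMeasurableFun.Build _ _ _ _ (@cons_pair n)
  (@measurable_cons_pair n).

Definition unit_interval_prob : probability (measurableTypeR R) R :=
  uniform_prob (@ltr01 R).

(* Lebesgue measure on [0, 1]^n, as an iterated product *)
Fixpoint unit_cube_prob (n : nat) : probability (n.-tuple R) R :=
  match n with
  | 0 => \d_ [tuple]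
  | m.+1 => distribution (unit_interval_prob \x unit_cube_prob m)%E
              (@cons_pair m)
  end.

Section measurable_torus_proj.
Context {d : nat}.

Let box (q : d.-tuple rat * nat) : set (d.-tuple R) :=
  \bigcap_(i in [set: 'I_d]) ((@tnth d R ^~ i) @^-1`
    `](ratr (tnth q.1 i) - q.2.+1%:R^-1), (ratr (tnth q.1 i) + q.2.+1%:R^-1)[).

Let measurable_box q : measurable (box q).
Proof.
apply: fin_bigcap_measurable => [|i _]; first exact: finite_finset.
by rewrite -[X in measurable X]setTI; apply: measurable_tnth.
Qed.

Lemma measurable_torus_proj :
  measurable_fun setT (@torus_proj R d).
Proof.
apply: (measurability (@open (torus R d))) => //.
move=> _ [U oU <-]; rewrite setTI.
rewrite (_ : _ @^-1` _ = \bigcup_(q in [set q | box q `<=` torus_proj @^-1` U])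
  box q); last first.
  apply/seteqP; split => [x Ux|x [q qU qx]]; last exact: qU.
  have [e /= e0 eU] : exists2 e : R, 0 < e &
      forall z, torus_dist (torus_proj x) z < e -> U z.
    have /nbhs_ballP[e e0 eU] : nbhs (torus_proj x) U by exact: open_nbhs_nbhs.
    by exists e => // z xz; apply: eU; rewrite ballEmdist.
  have [n ne] : exists n, n.+1%:R^-1 *+ 2 *+ d < e.
    have [n] := near_infty_natSinv_lt (PosNum (divr_gt0 e0 (ltr0Sn R (2 * d)))).
    move=> _ /(_ n (leqnn n)) /= ne; exists n.
    rewrite -mulrnA -(mulr_natr _ (2 * d)%N).
    move: ne; rewrite ltr_pdivlMr ?ltr0Sn//; apply: le_lt_trans.
    by rewrite ler_wpM2l// ler_nat.
  have n0 : 0 < n.+1%:R^-1 :> R by rewrite invr_gt0.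
  have /choice[q qx] : forall i, exists q : rat,
      ratr q \in `](tnth x i - n.+1%:R^-1), (tnth x i + n.+1%:R^-1)[.
    by move=> i; apply: rat_in_itvoo; rewrite ltrBlDr -addrA ltrDl addr_gt0.
  exists ([tuple q i | i < d], n) => /=; last first.
    move=> i _ /=; rewrite in_itv/= !tnth_mktuple.
    by move: (qx i); rewrite in_itv/= !ltrBlDr andbC.
  move=> y qy; apply: eU; apply: le_lt_trans (torus_dist_proj_le x y) _.
  apply: le_lt_trans ne.
  rewrite -[X in _ <= _ *+ X]card_ord -sumr_const; apply: ler_sum => i _.
  move: (qy i I) (qx i); rewrite /= !in_itv/= !tnth_mktuple.
  move: (ratr _) (_^-1) (tnth x i) (tnth y i) => u v z w.
  move=> /andP[? ?] /andP[? ?]; rewrite ler_norml mulr2n.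
  by apply/andP; split; lra.
rewrite bigcup_mkcond; apply: countable_bigcupT_measurable => [|q].
  exact: countableP.
by case: ifP => _.
Qed.

HB.instance Definition _ := isMeasurableFun.Build _ _ _ _ (@torus_proj R d)
  measurable_torus_proj.

End measurable_torus_proj.

Definition lebesgue_torus (d : nat) : probability (torus R d) R :=
  distribution (unit_cube_prob d) torus_proj.

End lebesgue_torus.

Section dimensions.
Context {R : realType} {T : metricType R}.
Implicit Types (A U : set T) (s delta r : R) (x : T).
Local Open Scope ereal_scope.

(* closed ball; the library's [closed_ball] is the closure of the open one *)
Definition cball x r : set T := [set y | (mdist x y <= r)%R].

(* adding 0 gives diam set0 = 0 and changes nothing when U is nonempty *)
Definition diam U : \bar R :=
  ereal_sup (0 |` [set (mdist p.1 p.2)%:E | p in U `*` U]).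

(* diam(U)^s, with the empty set counting for 0 even when s = 0 *)
Definition diam_pow s U : \bar R :=
  if U == set0 then 0 else diam U `^ s.

(* Finite covers are included: they are padded with the empty set. *)
Definition hausdorff_premeasure s delta A : \bar R :=
  ereal_inf [set \sum_(0 <= n <oo) diam_pow s (U n)
            | U in [set U : (set T)^nat |
                (forall n, diam (U n) <= delta%:E) /\ A `<=` \bigcup_n U n]].

Definition hausdorff_measure s A : \bar R :=
  ereal_sup [set hausdorff_premeasure s delta A
            | delta in [set delta | (0 < delta)%R]].

Definition hausdorff_dim A : \bar R :=
  ereal_inf [set s%:E | s in
    [set s | (0 <= s)%R /\ hausdorff_measure s A = 0]].

(* A delta-packing of A: an at most countable family of pairwise disjoint
   closed balls (indexed by D) with centres in A and radii at most delta. *)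
Definition is_packing delta A (D : set nat) (x : nat -> T) (r : nat -> R) :=
  [/\ forall i, D i -> A (x i),
      forall i, D i -> (0 < r i <= delta)%R &
      trivIset D (fun i => cball (x i) (r i))].

(* A ball of radius r counts for (2 r)^s; on the torus 2 r is its diameter as
   soon as r is small (and d > 0), which is all that matters in the limit. *)
Definition packing_premeasure_delta s delta A : \bar R :=
  ereal_sup [set z | exists D (x : nat -> T) (r : nat -> R), is_packing delta A D x r /\
    z = \esum_(i in D) ((2 * r i)%R `^ s)%:E].

Definition packing_premeasure s A : \bar R :=
  ereal_inf [set packing_premeasure_delta s delta A
            | delta in [set delta | (0 < delta)%R]].

Definition packing_measure s A : \bar R :=
  ereal_inf [set \sum_(0 <= n <oo) packing_premeasure s (U n)
            | U in [set U : (set T)^nat | A `<=` \bigcup_n U n]].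

Definition packing_dim A : \bar R :=
  ereal_inf [set s%:E | s in
    [set s | (0 <= s)%R /\ packing_measure s A = 0]].

End dimensions.

Section independence.
Context {R : realType} {dO dT : measure_display} {Omega : measurableType dO}
  {T : measurableType dT}.
Local Open Scope ereal_scope.

Definition independent_RVs (P : probability Omega R) (I : choiceType)
    (X : I -> {RV P >-> T}) : Prop :=
  forall (J : {fset I}) (B : I -> set T),
    (forall i, i \in J -> measurable (B i)) ->
    P (\bigcap_(i in [set` J]) (X i @^-1` B i)) =
    \prod_(i <- J) P (X i @^-1` B i).

End independence.

Section random_covering.
Context {R : realType} {d : nat}.

Definition uniform_on_torus {dO} {Omega : measurableType dO}
    (P : probability Omega R) (X : {RV P >-> torus R d}) : Prop :=
  forall B : set (torus R d), measurable B ->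
    distribution P X B = lebesgue_torus d B.

Definition iid_uniform {dO} {Omega : measurableType dO}
    (P : probability Omega R) (xi : nat -> {RV P >-> torus R d}) : Prop :=
  independent_RVs xi /\ forall n, uniform_on_torus (xi n).

(* Sequences are indexed from 0: [l n] and [x n] stand for l_(n+1) and
   x_(n+1). *)
Definition covering_exponent (l : nat -> R) : R :=
  sup [set s : R | 0 <= s <= d%:R /\
                   (\sum_(0 <= n <oo) (l n `^ s)%:E = +oo)%E].

Definition covering_set (l : nat -> R) (x : nat -> torus R d) :
    set (torus R d) :=
  lim_sup_set (fun n => cball (x n) (l n / 2)).

End random_covering.
Arguments covering_exponent {R} d l.

(* Main.v *)
Require Import Defs.
From mathcomp Require Import all_boot all_order all_algebra finmap.
From mathcomp Require Import all_classical all_reals all_analysis.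
From mathcomp Require Import ring lra zify.

Set Implicit Arguments.
Unset Strict Implicit.
Unset Printing Implicit Defensive.

Import Order.TTheory GRing.Theory Num.Theory.
Import numFieldNormedType.Exports.

Local Open Scope classical_set_scope.
Local Open Scope ring_scope.

(** Write [tau = t / d] and [beta = alpha / d]. The set [F] consists of the points
whose coordinates have binary digit [0] outside a set of free positions. All
positions from [q k = (2 k)!] to [p k = (2 k + 1)!] are free, so that [F] cannot
be told from the torus at the scale [2 ^- p k], which gives it packing dimension
[d]. From [p k] to [q (k + 1)] the free positions have density [tau]. As these
stretches grow faster than geometrically, the number of cubes of side
[2 ^- q k] that are needed to cover [F] is about [2 ^ (t * q k)], so its Hausdorff
dimension is at most [t].

The balls come in blocks. Those of the [k]-th block have radius [d * 2 ^- p k] and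
their number is [2 ^ (alpha * p k)], up to factors that do not affect the exponent
[alpha]. With [a k] about [beta * p k], they outnumber the dyadic cubes of
generation [a k] by a logarithmic factor, so by the Borel-Cantelli lemma almost
surely each of these cubes contains a centre as soon as [k] is large
([almost_surely_hit]). The ball around this centre contains the dyadic cube of
generation [p k] around it. Hence the digits at the positions from [a k] to [p k]
can be prescribed, as functions of the previous ones, so that the resulting point
lies in a ball of the [k]-th block. As all these positions are free, this produces
a Cantor set inside the intersection of [F] with the covering set
([hausdorff_dim_hit]). The digits that remain free are numerous enough: up to any
position [n], there are at least [g * n - C] free positions left, for each slope [g]
smaller than [min beta tau] ([unhit_free_rank_ge]). Indeed the positions from
[q k] to [a k] alone provide about [beta * p k] free ones, which last until the end
of the prescribed stretch at [p k], and from there on the rate is at least [tau].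

The lower bounds on dimensions rest on one device. A Cantor set of this kind is
parametrized by the unit interval, the binary digits of the parameter filling the
free positions in order. A cube of generation [n] then corresponds to an interval
of length [2 ^- (d * rank n)], where [rank n] counts the free positions below [n],
and the countable subadditivity of outer length plays the role of a measure on the
Cantor set. This gives the mass distribution principle [hausdorff_measure_tree],
hence the lower bounds on the Hausdorff dimensions of [F] and of the
intersection. It also shows that some member of any countable cover of [F] meets a
positive proportion of the cubes of each generation, hence the packing dimension
of [F] ([packing_measure_tree]). The upper bounds come from the natural covers, and
from comparing volumes in the case of packings. *)

(** * Hausdorff dimension in metric spaces *)

Section dimension_generalities.
Context {R : realType} {T : metricType R}.
Implicit Types (A B U : set T) (s a : R).
Local Open Scope ereal_scope.

Lemma diam_ge0 U : 0 <= diam U.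
Proof. by apply: ereal_sup_ubound; left. Qed.

Lemma mdist_diam U x y : U x -> U y -> (mdist x y)%:E <= diam U.
Proof. by move=> Ux Uy; apply: ereal_sup_ubound; right; exists (x, y). Qed.

Lemma diam_le U (r : R) : (0 <= r)%R ->
  (forall x y, U x -> U y -> (mdist x y <= r)%R) -> diam U <= r%:E.
Proof.
move=> r0 Ur; apply: ge_ereal_sup => _ [->|[[x y] [/= Ux Uy] <-]].
  by rewrite lee_fin.
by rewrite lee_fin Ur.
Qed.

Lemma diam_cball (x : T) (r : R) : (0 <= r)%R -> diam (cball x r) <= (2 * r)%:E.
Proof.
move=> r0; apply: diam_le => [|y z yr zr]; first by rewrite mulr_ge0.
by rewrite (le_trans (metric_triangle y x z))// mulrDl mul1r lerD// metric_sym.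
Qed.

Lemma diam_pow_ge0 s U : 0 <= diam_pow s U.
Proof. by rewrite /diam_pow; case: ifP => // _; exact: poweR_ge0. Qed.

Lemma diam_pow0 s : diam_pow s (@set0 T) = 0.
Proof. by rewrite /diam_pow eqxx. Qed.

Lemma diam_pow_le s U (r : R) : (0 <= s)%R -> (0 <= r)%R ->
  diam U <= r%:E -> diam_pow s U <= (r `^ s)%:E.
Proof.
move=> s0 r0 Ur; rewrite /diam_pow; case: ifP => _.
  by rewrite lee_fin powR_ge0.
rewrite -poweR_EFin; apply: gt0_ler_poweR => //.
  by rewrite in_itv/= diam_ge0 leey.
by rewrite in_itv/= lee_fin r0 leey.
Qed.

Lemma hausdorff_measure_ge0 s A : 0 <= hausdorff_measure s A.
Proof.
apply: (@le_trans _ _ (hausdorff_premeasure s 1 A)).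
  apply: le_ereal_inf_tmp => _ [U _ <-].
  by apply: nneseries_ge0 => n _ _; exact: diam_pow_ge0.
by apply: ereal_sup_ubound; exists 1%R => //=; exact: ltr01.
Qed.

Lemma hausdorff_measure_eq0 s A :
  (forall delta e : R, (0 < delta)%R -> (0 < e)%R -> exists U : (set T)^nat,
    [/\ forall n, diam (U n) <= delta%:E, A `<=` \bigcup_n U n &
        \sum_(0 <= n <oo) diam_pow s (U n) <= e%:E]) ->
  hausdorff_measure s A = 0.
Proof.
move=> AU; apply/eqP; rewrite eq_le hausdorff_measure_ge0 andbT.
apply: ge_ereal_sup => _ [delta /= d0 <-].
apply/lee_addgt0Pr => e e0; rewrite add0e.
have [U [Ud AU' Ue]] := AU _ _ d0 e0.
by apply: le_trans Ue; apply: ereal_inf_lbound; exists U.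
Qed.

Lemma hausdorff_measure_neq0 s A (delta c : R) : (0 < delta)%R -> (0 < c)%R ->
  (forall U : (set T)^nat, (forall n, diam (U n) <= delta%:E) ->
     A `<=` \bigcup_n U n -> c%:E <= \sum_(0 <= n <oo) diam_pow s (U n)) ->
  hausdorff_measure s A != 0.
Proof.
move=> d0 c0 AU; rewrite gt_eqF//.
apply: (@lt_le_trans _ _ c%:E); first by rewrite lte_fin.
apply: (@le_trans _ _ (hausdorff_premeasure s delta A)).
  by apply: le_ereal_inf_tmp => _ [U [Ud UA] <-]; exact: AU.
by apply: ereal_sup_ubound; exists delta.
Qed.

Lemma le_hausdorff_measure s A B :
  A `<=` B -> hausdorff_measure s A <= hausdorff_measure s B.
Proof.
move=> AB; apply: ge_ereal_sup => _ [delta d0 <-].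
apply: (@le_trans _ _ (hausdorff_premeasure s delta B)).
  apply: le_ereal_inf => _ [U [Ud UB] <-]; exists U => //; split => //.
  exact: subset_trans UB.
by apply: ereal_sup_ubound; exists delta.
Qed.

Lemma le_hausdorff_dim A B : A `<=` B -> hausdorff_dim A <= hausdorff_dim B.
Proof.
move=> AB; apply: le_ereal_inf => _ [s [s0 Bs] <-]; exists s => //; split => //.
apply/eqP; rewrite eq_le hausdorff_measure_ge0 andbT -Bs.
exact: le_hausdorff_measure.
Qed.

Lemma hausdorff_dim_le a A : (0 <= a)%R ->
  (forall s, (a < s)%R -> hausdorff_measure s A = 0) -> hausdorff_dim A <= a%:E.
Proof.
move=> a0 As; apply/lee_addgt0Pr => e e0.
apply: ereal_inf_lbound; exists (a + e)%R; last by rewrite EFinD.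
by split; [rewrite addr_ge0// ltW|rewrite As// ltrDl].
Qed.

Lemma hausdorff_dim_ge a A :
  (forall s, (0 <= s < a)%R -> hausdorff_measure s A != 0) ->
  a%:E <= hausdorff_dim A.
Proof.
move=> As; apply: le_ereal_inf_tmp => _ [s [s0 /eqP sA] <-].
by rewrite lee_fin leNgt; apply: contraL sA => sa; apply: As; rewrite s0.
Qed.

(** The limsup set is covered by each tail of the sequence of balls, and the
    tails of a convergent series tend to zero. *)
Lemma hausdorff_measure_limsup s (x : nat -> T) (r : nat -> R) :
  (0 < s)%R -> (forall n, (0 <= r n)%R) ->
  \sum_(0 <= n <oo) ((2 * r n) `^ s)%:E < +oo ->
  hausdorff_measure s (lim_sup_set (fun n => cball (x n) (r n))) = 0.
Proof.
move=> s0 r0 rs; apply: hausdorff_measure_eq0 => delta e d0 e0.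
pose u n := ((2 * r n) `^ s)%:E.
have u0 n : 0 <= u n by rewrite lee_fin powR_ge0.
have r20 n : (0 <= 2 * r n)%R by rewrite mulr_ge0.
pose m := Num.min e (delta `^ s)%R.
have m0 : (0 < m)%R by rewrite lt_min e0 powR_gt0.
have [N uN] : exists N, \sum_(N <= n <oo) u n < m%:E.
  have /fine_cvgP[f /cvgrPdist_lt/(_ _ m0) h] :=
    nneseries_tail_cvg rs (fun n _ => u0 n).
  near \oo => N; exists N.
  have fN : \sum_(N <= k <oo) u k \is a fin_num by near: N; exact: f.
  have : (`|0 - fine (\sum_(N <= k <oo) u k)| < m)%R by near: N; exact: h.
  rewrite sub0r normrN -(fineK fN) lte_fin; apply: le_lt_trans.
  exact: ler_norm.
exists (fun n => cball (x (n + N)%N) (r (n + N)%N)).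
have tailE : \sum_(N <= n <oo) u n = \sum_(0 <= n <oo) u (n + N)%N.
  by rewrite -(nneseries_addn N u0).
split.
- move=> n; apply: (le_trans (diam_cball _ (r0 _))); rewrite lee_fin.
  rewrite leNgt; apply/negP => dr.
  have : u (n + N)%N < (delta `^ s)%:E.
    apply: le_lt_trans (lt_le_trans uN _); last by rewrite lee_fin /m ge_min lexx orbT.
    rewrite tailE.
    apply: (@le_trans _ _ (\sum_(0 <= k < n.+1) u (k + N)%N)).
      by rewrite big_nat_recr//= leeDr//; apply: sume_ge0.
    exact: nneseries_lim_ge.
  rewrite lte_fin ltNge; apply/negP; rewrite negbK.
  by apply: ge0_ler_powR; rewrite ?nnegrE; try exact: ltW; exact: r20.
- move=> y /(_ N I)[n /= Nn yn]; exists (n - N)%N => //.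
  by rewrite subnK.
- apply: (@le_trans _ _ (\sum_(0 <= n <oo) u (n + N)%N)).
    apply: lee_nneseries => [n _ _|n _]; first exact: diam_pow_ge0.
    by apply: diam_pow_le; [exact: ltW|exact: r20|exact: diam_cball].
  by rewrite -tailE; apply/ltW/(lt_le_trans uN); rewrite lee_fin /m ge_min lexx.
Unshelve. all: by end_near.
Qed.

End dimension_generalities.

(** * Outer length *)

Section outer_length.
Context {R : realType}.
Local Open Scope ereal_scope.

(** An outer measure, because the sets of parameters measured below come from
    arbitrary covers and need not be measurable. *)
Definition outer_length (A : set R) : \bar R := (wlength idfun)^*%mu A.

Lemma outer_length_ge0 A : 0 <= outer_length A.
Proof. exact: outer_measure_ge0. Qed.

Lemma outer_length0 : outer_length set0 = 0.
Proof. exact: outer_measure0. Qed.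

Lemma le_outer_length A B : A `<=` B -> outer_length A <= outer_length B.
Proof. exact: (@le_mu_ext _ _ _ (wlength idfun)). Qed.

Lemma outer_length_bigcup (A : (set R)^nat) :
  outer_length (\bigcup_n A n) <= \sum_(0 <= n <oo) outer_length (A n).
Proof. exact: outer_measure_sigma_subadditive. Qed.

Lemma outer_length_itv_co (a b : R) : (a <= b)%R ->
  outer_length `[a, b[ = (b - a)%:E.
Proof.
move=> ab; have := @lebesgue_measure_itv R (`[a, b[).
rewrite /= lte_fin => h; rewrite -[LHS]/(lebesgue_measure _) h.
by case: ltgtP ab => // -> _; rewrite subrr.
Qed.

Lemma outer_length_bigcup_fin (I : finType) (A : I -> set R) (P : pred I) (r : R) :
  (0 <= r)%R -> (forall i, P i -> outer_length (A i) <= r%:E) ->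
  outer_length (\bigcup_(i in [set i | P i]) A i) <= (r *+ #|P|)%:E.
Proof.
move=> r0 Ar.
suff h (s : seq I) : outer_length (\bigcup_(i in [set i | i \in s /\ P i]) A i)
    <= (r *+ count P s)%:E.
  have := h (enum I).
  have -> : count P (enum I) = #|P| by rewrite -size_filter cardE enumT.
  apply: le_trans; apply: le_outer_length => x [i /= Pi Ax].
  by exists i => //=; split; rewrite ?mem_enum.
have U A' B' : outer_length (A' `|` B') <= outer_length A' + outer_length B'.
  exact: outer_measureU2.
elim: s => [|i s ih].
  rewrite (_ : \bigcup_(_ in _) _ = set0) ?mulr0n; first by rewrite outer_length0.
  by rewrite -subset0 => x [i [/=]]; rewrite in_nil.
apply: (@le_trans _ _ (outer_length ((if P i then A i else set0) `|`
   \bigcup_(i in [set i | i \in s /\ P i]) A i))).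
  apply: le_outer_length => x [j [/=]]; rewrite inE => /predU1P[->|js] Pj Aj.
    by left; rewrite Pj.
  by right; exists j.
apply: le_trans (U _ _) _; rewrite /= mulrnDr EFinD leeD//.
case: ifP => [/Ar//|_]; by rewrite outer_length0.
Qed.

End outer_length.

(** * Coordinates on the torus *)

Section torus_coordinates.
Context {R : realType} {d : nat}.
Implicit Types (x y z : 'I_d -> R).

Definition tproj x : torus R d := torus_proj [tuple x i | i < d].

Lemma tproj_tcoord (p : torus R d) : tproj (tcoord p) = p.
Proof.
apply: tcoord_inj => i; rewrite tcoord_proj tnth_mktuple.
have /andP[p0 p1] := tcoord_itv p i.
by rewrite (@floor_def _ _ 0) ?subr0// p0.
Qed.

Lemma mdist_tproj_le x y (r : R) : (forall i, `|x i - y i| <= r) ->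
  mdist (tproj x) (tproj y) <= d%:R * r.
Proof.
move=> xy; apply: le_trans (torus_dist_proj_le _ _) _.
rewrite mulr_natl -[X in _ <= _ *+ X]card_ord -sumr_const.
by apply: ler_sum => i _; rewrite !tnth_mktuple.
Qed.

Lemma mdist_tproj_lt x y (r : R) : mdist (tproj x) (tproj y) < r ->
  exists k : 'I_d -> int, forall i, `|x i - y i + (k i)%:~R| < r.
Proof.
rewrite -subr_gt0 => xyr.
have [k] := torus_dist_adherent (tproj x) (tproj y) xyr.
rewrite addrC subrK => kr.
exists (fun i => k i - Num.floor (x i) + Num.floor (y i)) => i.
apply: le_lt_trans kr; apply: le_trans (ler_norm_enorm _ i).
rewrite /= !tcoord_proj !tnth_mktuple intrD intrB le_eqVlt; apply/orP; left.
by apply/eqP; congr `|_|; ring.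
Qed.

(** A dyadic cube of generation [n] is known by the coordinates of its lower
    corner, in units of [2 ^- n]. *)
Definition code := {ffun 'I_d -> nat}.

Definition corner n (c : code) : torus R d := tproj (fun i => (c i)%:R / 2 ^+ n).

(** Open cubes are Borel for free, and only lower bounds on their measure
    matter, so the missing faces do no harm. *)
Definition ocube n (c : code) : set (torus R d) :=
  [set p | forall i, (c i)%:R < 2 ^+ n * tcoord p i < (c i).+1%:R].

Lemma exp2_gt0 n : 0 < 2 ^+ n :> R.
Proof. by rewrite exprn_gt0. Qed.

Lemma ocube_open n (c : code) : (forall i, c i < 2 ^ n)%N -> open (ocube n c).
Proof.
move=> cn; rewrite openE => p pc; apply/nbhs_ballP.
pose g i := Num.min (2 ^+ n * tcoord p i - (c i)%:R)
                    ((c i).+1%:R - 2 ^+ n * tcoord p i).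
pose e := \big[Num.min/1]_(i < d) g i.
have e0 : 0 < e.
  rewrite /e; elim/big_ind: _ => // [a b a0 b0|i _]; first by rewrite lt_min a0.
  by rewrite /g lt_min !subr_gt0 pc.
exists (e / 2 ^+ n); first by rewrite /= divr_gt0// exp2_gt0.
move=> q; rewrite ballEmdist/= -(tproj_tcoord p) -(tproj_tcoord q).
move=> /mdist_tproj_lt[k kpq] i.
have ei : e <= g i by rewrite /e (bigD1 i)//= ge_min lexx.
have := kpq i; rewrite ltr_pdivlMr ?exp2_gt0//.
rewrite -[X in _ * X](gtr0_norm (exp2_gt0 n)) -normrM ltr_norml => /andP[h1 h2].
move: ei; rewrite /g le_min => /andP[e1 e2].
have /andP[q0 q1] := tcoord_itv q i.
have a0 : 0 <= (c i)%:R :> R by [].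
have b0 : (c i).+1%:R <= 2 ^+ n :> R by rewrite -natrX ler_nat.
have k0 : k i = 0.
  have : -1 < (k i)%:~R :> R /\ (k i)%:~R < 1 :> R.
    have z0 := exp2_gt0 n.
    split; rewrite -(ltr_pM2r z0); nra.
  by rewrite (_ : -1 = (-1)%:~R :> R)// (_ : 1 = 1%:~R :> R)// !ltr_int; lia.
rewrite tproj_tcoord.
move: h1 h2; rewrite k0 addr0 mulrBl => h1 h2.
by apply/andP; split; lra.
Qed.

Lemma ocube_measurable n (c : code) : (forall i, c i < 2 ^ n)%N -> measurable (ocube n c).
Proof. by move=> cn; apply: sub_sigma_algebra; exact: ocube_open. Qed.

End torus_coordinates.
Arguments code d : clear implicits.

(** * Lebesgue measure of dyadic cubes *)

Section cube_measure.
Context {R : realType}.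
Local Open Scope ereal_scope.

Lemma unit_interval_prob_oo (a b : R) : (0 <= a)%R -> (a <= b)%R -> (b <= 1)%R ->
  unit_interval_prob `]a, b[%classic = (b - a)%:E.
Proof.
move=> a0 ab b1.
rewrite /= /uniform_prob integral_uniform_pdf setIidl; last first.
  move=> x /=; rewrite !in_itv/= => /andP[ax xb].
  by rewrite (le_trans a0 (ltW ax)) (le_trans (ltW xb) b1).
rewrite (eq_integral (cst 1)); last first.
  move=> x; rewrite inE/= in_itv/= => /andP[ax xb].
  by rewrite /uniform_pdf (le_trans a0 (ltW ax)) (le_trans (ltW xb) b1)/= subr0 invr1.
rewrite integral_cst//= mul1e lebesgue_measure_itv/= lte_fin.
by case: ltgtP ab => // -> _; rewrite subrr.
Qed.

(** The bounds are indexed by all natural numbers so that an induction on the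
    dimension can shift them. *)
Definition open_box n (a b : nat -> R) : set (n.-tuple R) :=
  [set v | forall i : 'I_n, (a i < tnth v i < b i)%R].
Arguments open_box n a b : clear implicits.

Lemma open_box_measurable n (a b : nat -> R) : measurable (open_box n a b).
Proof.
rewrite (_ : open_box n a b = \bigcap_(i in [set: 'I_n])
  ((@tnth n R ^~ i) @^-1` `]a i, b i[)); last first.
  apply/seteqP; split => v vab i => [_|]; first by rewrite /= in_itv/= vab.
  by have := vab i I; rewrite /= in_itv.
apply: fin_bigcap_measurable => [|i _]; first exact: finite_finset.
by rewrite -[X in measurable X]setTI; apply: measurable_tnth.
Qed.

Lemma unit_cube_prob_box n (a b : nat -> R) :
  (forall i, (0 <= a i)%R /\ (a i <= b i)%R /\ (b i <= 1)%R) ->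
  unit_cube_prob n (open_box n a b) = (\prod_(i < n) (b i - a i)%R)%:E.
Proof.
elim: n a b => [|n ih] a b ab.
  rewrite big_ord0/= diracE mem_set//= => -[]//.
rewrite big_ord_recl/= /distribution/= /pushforward.
rewrite (_ : _ @^-1` _ =
  `]a 0%N, b 0%N[%classic `*` open_box n (fun i => a i.+1) (fun i => b i.+1)); last first.
  apply/seteqP; split => -[x v] /=.
    move=> xv; split; first by have := xv ord0; rewrite in_itv/= (tnth_nth (0 : R)%R)/=.
    by move=> i; have := xv (lift ord0 i); rewrite !(tnth_nth (0 : R)%R)/=.
  move=> [] /=; rewrite in_itv/= => x0 vab i.
  case: (unliftP ord0 i) => [j ->|->]; rewrite (tnth_nth (0 : R)%R)//=.
  by have := vab j; rewrite (tnth_nth (0 : R)%R).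
rewrite product_measure1E//; last exact: open_box_measurable.
rewrite EFinM; congr (_ * _); last by apply: ih => i; exact: ab.
by have [? []] := ab 0%N; exact: unit_interval_prob_oo.
Qed.

Lemma lebesgue_torus_ocube d n (c : code d) : (forall i, c i < 2 ^ n)%N ->
  ((2 ^+ (n * d))^-1)%:E <= lebesgue_torus d (@ocube R d n c).
Proof.
move=> cn.
pose a i : R := (if insub i is Some j then (c j)%:R / 2 ^+ n else 0)%R.
pose b i : R := (a i + (2 ^+ n)^-1)%R.
have z0 := @exp2_gt0 R n.
have aE (i : 'I_d) : a i = ((c i)%:R / 2 ^+ n)%R by rewrite /a valK.
have a0 i : (0 <= a i)%R.
  by rewrite /a; case: insubP => // j _ _; rewrite divr_ge0// ltW.
have b1 i : (b i <= 1)%R.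
  rewrite /b /a; case: insubP => [j _ _|_].
    rewrite -[X in (_ + X)%R]mul1r -mulrDl ler_pdivrMr// mul1r natr1.
    by rewrite -natrX ler_nat.
  by rewrite add0r invf_le1// -natrX ler1n expn_gt0.
have -> : ((2 ^+ (n * d))^-1)%:E = unit_cube_prob d (open_box d a b).
  rewrite unit_cube_prob_box => [|i]; last first.
    by split; [exact: a0|split; [rewrite /b lerDl invr_ge0 ltW|exact: b1]].
  congr EFin; rewrite (eq_bigr (fun=> (2 ^+ n)^-1)%R); last first.
    by move=> i _; rewrite /b addrAC subrr add0r.
  by rewrite big_const_ord iter_mulr_1 exprVn -exprM.
apply: le_measure; rewrite ?inE.
- exact: open_box_measurable.
- rewrite -[X in measurable X]setTI; apply: measurable_torus_proj => //.
  exact: ocube_measurable.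
- move=> v vab i; have /andP[av vb] := vab i.
  rewrite tcoord_proj (@floor_def _ _ 0); last first.
    by rewrite (le_trans (a0 i) (ltW av))/= add0r (lt_le_trans vb).
  move: av vb; rewrite subr0 /b aE -[X in (_ + X)%R]mul1r -mulrDl natr1.
  by rewrite ltr_pdivrMr// ltr_pdivlMr// ![(tnth v i * _)%R]mulrC => -> ->.
Qed.

End cube_measure.

(** * Binary digits and dyadic trees *)

Section binary_digits.
Context {R : realType}.
Implicit Types u v : R.

Definition bit u j : bool := odd (Num.truncn (2 ^+ j.+1 * u)).

Lemma truncn_half u : 0 <= u -> (Num.truncn (2 * u))./2 = Num.truncn u.
Proof.
move=> u0; apply/esym/truncn_def.
have /andP[] := @truncn_itv R (2 * u) (mulr_ge0 (ler0n _ 2) u0).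
set m := Num.truncn _; rewrite -{1 2}(odd_double_half m).
rewrite -!natr1 -muln2 !natrD natrM => h1 h2.
have : (odd m)%:R <= 1 :> R by rewrite (_ : 1 = 1%:R)// ler_nat; case: odd.
have : 0 <= (odd m)%:R :> R by [].
move=> ? ?; apply/andP; split; lra.
Qed.

Lemma truncn_bits u v b : 0 <= u < 1 -> 0 <= v < 1 ->
  (forall j, (j < b)%N -> bit u j = bit v j) ->
  Num.truncn (2 ^+ b * u) = Num.truncn (2 ^+ b * v).
Proof.
move=> /andP[u0 u1] /andP[v0 v1]; elim: b => [|b ih] uv.
  by rewrite expr0 !mul1r !(@truncn_def _ _ 0) ?u0 ?v0.
have hb w : 0 <= w -> Num.truncn (2 ^+ b.+1 * w) =
    (bit w b + (Num.truncn (2 ^+ b * w)).*2)%N.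
  move=> w0; rewrite -[LHS]odd_double_half exprS -mulrA truncn_half//.
    by rewrite /bit exprS mulrA.
  by rewrite mulr_ge0// exprn_ge0.
by rewrite !hb// uv// ih// => j jb; apply: uv; exact: ltnW.
Qed.

Lemma outer_length_truncn (k b : nat) :
  (outer_length [set u : R | (0 <= u)%R /\ Num.truncn (2 ^+ b * u)%R = k] <=
   ((2 ^+ b)^-1)%:E)%E.
Proof.
have z0 := @exp2_gt0 R b.
apply: (@le_trans _ _ (outer_length `[k%:R / 2 ^+ b, k.+1%:R / 2 ^+ b[%classic)).
  apply: le_outer_length => u [u0 <-]; rewrite /= in_itv/=.
  have /andP[] := @truncn_itv R (2 ^+ b * u) (mulr_ge0 (ltW z0) u0).
  by rewrite ler_pdivrMr// ltr_pdivlMr// ![u * _]mulrC => -> ->.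
rewrite outer_length_itv_co; last by rewrite ler_pM2r ?invr_gt0// ler_nat.
by rewrite -mulrBl -natrB// subSnn mul1r.
Qed.

End binary_digits.

Section dyadic_limit.
Context {R : realType} {d : nat} (c : nat -> code d).
Hypothesis c0 : forall i, c 0%N i = 0%N.
Hypothesis cS : forall n i, (c n.+1 i)./2 = c n i.

Lemma dyadic_div n m i : c n i = (c (m + n) i %/ 2 ^ m)%N.
Proof.
elim: m => [|m ih]; first by rewrite add0n expn0 divn1.
by rewrite expnS divnMA divn2 addSn cS -ih.
Qed.

Lemma dyadic_lt n i : (c n i < 2 ^ n)%N.
Proof.
elim: n => [|n ih]; first by rewrite c0.
rewrite expnS mul2n -(odd_double_half (c n.+1 i)) cS.
by case: odd; move: ih; rewrite -!mul2n; lia.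
Qed.

Definition dyadic_lim (i : 'I_d) : R := sup [set (c n i)%:R / 2 ^+ n | n in setT].

Lemma dyadic_lim_itv n i :
  (c n i)%:R <= 2 ^+ n * dyadic_lim i <= (c n i).+1%:R.
Proof.
have z0 k := @exp2_gt0 R k.
have up m k : (c m i)%:R / 2 ^+ m <= (c k i).+1%:R / 2 ^+ k :> R.
  rewrite ler_pdivrMr// mulrAC ler_pdivlMr// -!natrX -!natrM ler_nat.
  have [mk|km] := leqP m k.
    rewrite (dyadic_div m (k - m) i) subnK//.
    have -> : (2 ^ k = 2 ^ (k - m) * 2 ^ m)%N by rewrite -expnD subnK.
    rewrite mulnA leq_mul2r (leq_trans (leq_divM _ _))//.
    by rewrite orbT.
  rewrite (dyadic_div k (m - k) i) subnK; last exact: ltnW.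
  have -> : (2 ^ m = 2 ^ (m - k) * 2 ^ k)%N by rewrite -expnD subnK// ltnW.
  rewrite mulnA leq_mul2r.
  by rewrite ltnW ?orbT// ltn_ceil// expn_gt0.
have ub : has_sup [set ((c n i)%:R / 2 ^+ n : R) | n in setT].
  split; first by eexists; exists 0%N.
  by exists ((c 0%N i).+1%:R / 2 ^+ 0) => _ [m _ <-]; exact: up.
rewrite ![2 ^+ n * _]mulrC; apply/andP; split.
  rewrite -ler_pdivrMr//; apply: ub_le_sup; [by case: ub|by exists n].
rewrite -ler_pdivlMr//; apply: ge_sup; [by case: ub|].
by move=> _ [m _ <-]; exact: up.
Qed.

Lemma dyadic_lim_corner n :
  mdist (corner n (c n)) (tproj dyadic_lim) <= d%:R / 2 ^+ n.
Proof.
apply: mdist_tproj_le => i; have z0 := @exp2_gt0 R n.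
have /andP[h1 h2] := dyadic_lim_itv n i.
rewrite ler_norml lerBrDr lerBlDr -(ler_pM2r z0) -[_ <= _ + _](ler_pM2r z0).
rewrite !mulrDl mulNr divfK ?gt_eqF// mulVf ?gt_eqF// ![_ * 2 ^+ n]mulrC.
move: h2; rewrite -natr1 => h2; apply/andP; split; lra.
Qed.

End dyadic_limit.

Section dyadic_tree.
Context {R : realType} {d : nat}.
Variables (free : pred nat) (h : nat -> code d -> 'I_d -> bool).
Implicit Types u v : R.

Definition rank n := (\sum_(0 <= j < n) free j)%N.

Lemma rankS n : rank n.+1 = (rank n + free n)%N.
Proof. by rewrite /rank big_nat_recr. Qed.

(** The free generations of the path of [u] are filled with the successive
    binary digits of [u], which are thus recovered from the path; the other
    generations are prescribed by [h]. *)
Fixpoint tree_path u n : code d :=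
  if n is m.+1 then
    [ffun i => (tree_path u m i).*2 +
       (if free m then bit u (d * rank m + i) else h m (tree_path u m) i)]%N
  else [ffun=> 0%N].

Lemma tree_pathS u n i : tree_path u n.+1 i = ((tree_path u n i).*2 +
  (if free n then bit u (d * rank n + i) else h n (tree_path u n) i))%N.
Proof. by rewrite ffunE. Qed.

Lemma tree_path0 u i : tree_path u 0 i = 0%N. Proof. by rewrite ffunE. Qed.

Lemma tree_path_half u n i : (tree_path u n.+1 i)./2 = tree_path u n i.
Proof. by rewrite tree_pathS addnC half_bit_double. Qed.

Lemma tree_path_bits u v n : tree_path u n = tree_path v n ->
  forall j, (j < d * rank n)%N -> bit u j = bit v j.
Proof.
elim: n => [|n ih] uv j; first by rewrite /rank big_geq// muln0.
have uvn : tree_path u n = tree_path v n.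
  by apply/ffunP => i; rewrite -[LHS]tree_path_half uv tree_path_half.
rewrite rankS mulnDr; have [jn _|nj jd] := ltnP j (d * rank n); first exact: ih.
have := tree_pathS u n; have := tree_pathS v n; rewrite -uv -uvn.
case: (free n) jd => /= [jd eu ev|]; last by rewrite muln0 addn0 ltnNge nj.
have jd' : (j - d * rank n < d)%N by rewrite ltn_subLR// -[X in (_ + X)%N]muln1.
have := eu (Ordinal jd'); rewrite ev /= subnKC//.
by case: (bit u j); case: (bit v j); lia.
Qed.

Definition tree_point u : torus R d := tproj (dyadic_lim (tree_path u)).

Definition tree_preimage (U : set (torus R d)) : set R :=
  [set u | 0 <= u < 1 /\ U (tree_point u)].

(** Parameters whose paths agree up to generation [n] share their first
    [d * rank n] binary digits, so they lie in an interval of length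
    [2 ^- (d * rank n)]. *)
Lemma outer_length_tree (I : finType) (P : pred I) (f : I -> code d) n
    (E : set R) :
  E `<=` [set u | 0 <= u < 1] ->
  (forall u, E u -> exists2 i, P i & tree_path u n = f i) ->
  (outer_length E <= ((2 ^+ (d * rank n))^-1 *+ #|P|)%:E)%E.
Proof.
move=> E01 Ef.
pose A i := [set u : R | 0 <= u < 1 /\ tree_path u n = f i].
apply: (@le_trans _ _ (outer_length (\bigcup_(i in [set i | P i]) A i))).
  by apply: le_outer_length => u Eu; have [i Pi ui] := Ef u Eu;
    exists i => //; split => //; exact: E01.
apply: outer_length_bigcup_fin; first by rewrite invr_ge0 exprn_ge0.
move=> i Pi; have [[v [v01 vi]]|/forallNP Ai] := pselect (exists v, A i v).
  apply: (le_trans _ (outer_length_truncn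
    (Num.truncn (2 ^+ (d * rank n) * v)) (d * rank n))).
  apply: le_outer_length => u [u01 ui]; split; first by case/andP: u01.
  by apply: truncn_bits => // j jn; apply: tree_path_bits jn; rewrite ui vi.
rewrite (_ : A i = set0) ?outer_length0 ?lee_fin ?invr_ge0 ?exprn_ge0//.
by rewrite -subset0 => u /Ai.
Qed.

Lemma tree_path_lt u n i : (tree_path u n i < 2 ^ n)%N.
Proof.
by apply: dyadic_lt => [j|m j]; [exact: tree_path0|exact: tree_path_half].
Qed.

(** The integer [k] accounts for the opposite faces that the torus glues. *)
Lemma tree_path_near u v n (m : nat) :
  mdist (tree_point u) (tree_point v) < m%:R / 2 ^+ n -> forall i,
  exists k : int, (`|(tree_path u n i)%:Z - (tree_path v n i)%:Z +
                     (2 ^ n)%N%:Z * k| < m.+1%:Z)%R.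
Proof.
move=> /mdist_tproj_lt[k kuv] i; exists (k i); have z0 := @exp2_gt0 R n.
have /andP[a1 a2] := @dyadic_lim_itv R d _ (tree_path_half u) n i.
have /andP[b1 b2] := @dyadic_lim_itv R d _ (tree_path_half v) n i.
have := kuv i; rewrite -(ltr_pM2r z0) divfK ?gt_eqF//.
rewrite -[X in _ * X < _](gtr0_norm z0) -normrM ltr_norml => /andP[h1 h2].
set a := tree_path u n i in a1 a2 *; set b := tree_path v n i in b1 b2 *.
rewrite ltr_norml -!(ltr_int R) mulrNz !intrD !intrM mulrNz -!pmulrn natrX.
move: a2 b2; rewrite -[a.+1%:R]natr1 -[b.+1%:R]natr1 -[m.+1%:R]natr1 => a2 b2.
by apply/andP; split; nra.
Qed.

(** Two points closer than [2 ^- n] lie in the same cube or in adjacent ones;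
    there are three possibilities in each direction. *)
Lemma tree_path_close u v n : mdist (tree_point u) (tree_point v) < (2 ^+ n)^-1 ->
  exists delta : {ffun 'I_d -> 'I_3}, forall i,
    tree_path v n i = ((tree_path u n i + 2 ^ n + delta i - 1) %% 2 ^ n)%N.
Proof.
rewrite -[X in _ < X]mul1r => /(tree_path_near (m := 1)) near_uv.
suff /choice[g gE] : forall i, exists e : 'I_3,
    tree_path v n i = ((tree_path u n i + 2 ^ n + e - 1) %% 2 ^ n)%N.
  by exists [ffun i => g i] => i; rewrite ffunE.
move=> i; have [k] := near_uv i; rewrite ltr_norml.
have := tree_path_lt u n i; have := tree_path_lt v n i.
set a := tree_path u n i; set b := tree_path v n i; set N := (2 ^ n)%N.
move=> bn an near_ab; have [e eE] : exists e : nat, (b%:Z - a%:Z - N%:Z * k + 1 = e%:Z)%R.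
  by exists `|(b%:Z - a%:Z - N%:Z * k + 1)%R|%N; lia.
have [j jE] : exists j : nat, (1 - k = j%:Z)%R.
  exists `|(1 - k)%R|%N; rewrite gez0_abs//.
  have [//|k1] := lerP 0 (1 - k)%R; nia.
have e3 : (e < 3)%N by lia.
exists (Ordinal e3) => /=.
have -> : (a + N + e - 1 = j * N + b)%N.
  have -> : (j * N = `|((1 - k) * N%:Z)%R|)%N by rewrite jE -PoszM absz_nat.
  have : 0 <= (1 - k) * N%:Z by rewrite jE.
  move: ((1 - k) * N%:Z)%R (mulrBl N%:Z 1 (k)) => w; rewrite mul1r => ew w0.
  move: ew eE near_ab; rewrite [k * _]mulrC; move: (N%:Z * k)%R => y *.
  lia.
by rewrite modnMDl modn_small.
Qed.

End dyadic_tree.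

(** * Dimensions of sets containing a dyadic tree *)

Section tree_dimension.
Context {R : realType} {d : nat}.
Variables (free : pred nat) (h : nat -> code d -> 'I_d -> bool).
Implicit Types u v : R.
Local Notation point := (@tree_point R d free h).
Local Notation preimage := (@tree_preimage R d free h).
Local Notation rank := (rank free).
Local Open Scope ereal_scope.

Lemma tree_preimage_cover (A : set (torus R d)) (U : (set (torus R d))^nat) :
  (forall u, (0 <= u < 1)%R -> A (point u)) -> A `<=` \bigcup_j U j ->
  1 <= \sum_(0 <= j <oo) outer_length (preimage (U j)).
Proof.
move=> Au AU; apply: le_trans (outer_length_bigcup _).
rewrite -[X in X <= _](_ : outer_length `[0%R, 1%R[%classic = 1).
  apply: le_outer_length => u /=; rewrite in_itv/= => u01.
  by have [j _ Uj] := AU _ (Au _ u01); exists j.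
by rewrite outer_length_itv_co// subr0.
Qed.

Section Hausdorff_lower_bound.
Variables (s C : R).
Hypothesis s0 : (0 <= s)%R.
Hypothesis rank_ge : forall n, (s * n%:R - C <= (d * rank n)%:R)%R.

Let K := ((2 `^ s * 2 `^ C) *+ #|{: {ffun 'I_d -> 'I_3}}|)%R.

Let K_gt0 : (0 < K)%R.
Proof.
rewrite /K pmulrn_lgt0 ?mulr_gt0 ?powR_gt0// card_ffun !card_ord.
by rewrite expn_gt0.
Qed.

(** A set of diameter less than [2 ^- n] meets at most [3 ^ d] dyadic cubes of
    generation [n], each of which takes a share [2 ^- (d * rank n)] of the
    parameters; [n] is chosen so that [2 ^- n] is comparable to [r]. *)
Lemma outer_length_preimage_small (U : set (torus R d)) (r : R) :
  (0 < r <= 1)%R -> (forall x y, U x -> U y -> (mdist x y < r)%R) ->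
  outer_length (preimage U) <= (K * r `^ s)%:E.
Proof.
move=> /andP[r0 r1] Ur.
have [n rn nr] : exists2 n, (r <= (2 ^+ n)^-1)%R & ((2 ^+ n.+1)^-1 <= r)%R.
  have ex : exists n, ((2 ^+ n.+1)^-1 <= r)%R.
    exists (Num.truncn r^-1); rewrite -[leRHS]invrK lef_pV2 ?posrE ?invr_gt0//.
    apply: ltW; apply: lt_trans (truncnS_gt _) _.
    by rewrite -natrX ltr_nat ltn_expl.
  case: (ex_minnP ex) => -[|n] nr nmin; first by exists 0%N; rewrite // expr0 invr1.
  exists n.+1 => //; apply: ltW; rewrite ltNge; apply/negP => /nmin.
  by rewrite ltnn.
have Kpos : (0 <= K * r `^ s)%R by rewrite mulr_ge0 ?powR_ge0// ltW.
have [->|/set0P[u0 [u001 Uu0]]] := eqVneq (preimage U) set0.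
  by rewrite outer_length0.
apply: le_trans (@outer_length_tree R d free h {ffun 'I_d -> 'I_3} predT
  (fun delta => [ffun i => (tree_path free h u0 n i + 2 ^ n + delta i - 1)
                           %% 2 ^ n]%N) n _ _ _) _.
- by move=> u [].
- move=> u [u01 Uu].
  have /tree_path_close[delta h'] : (mdist (point u0) (point u) < (2 ^+ n)^-1)%R.
    by apply: lt_le_trans rn; exact: Ur.
  by exists delta => //; apply/ffunP => i; rewrite ffunE h'.
rewrite lee_fin /K mulrnAl lerMn2r; apply/orP; right.
have -> : ((2 ^+ (d * rank n))^-1 = 2 `^ (- (d * rank n)%:R) :> R)%R.
  by rewrite powR_invn.
apply: (@le_trans _ _ (2 `^ (C - s * n%:R))%R).
  by apply: ler_powR => //; [rewrite ler1n|rewrite lerNl opprB].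
apply: (@le_trans _ _ (2 `^ s * 2 `^ C * ((2 ^+ n.+1)^-1) `^ s)%R); last first.
  rewrite ler_wpM2l ?mulr_ge0 ?powR_ge0//.
  by apply: ge0_ler_powR; rewrite ?nnegrE ?invr_ge0 ?exprn_ge0 ?(ltW r0).
rewrite -powR_invn// -powRrM -!powRD ?pnatr_eq0 ?implybT//.
by apply: ler_powR; [rewrite ler1n|rewrite -natr1; lra].
Qed.

(** For a set of positive diameter [r] the scale [2 * r] will do. A set of
    diameter zero is small at every scale, which leaves it no mass if [s > 0]. *)
Lemma outer_length_preimage_diam (U : set (torus R d)) :
  diam U <= (2^-1)%:E -> outer_length (preimage U) <= (K * 2 `^ s)%:E * diam_pow s U.
Proof.
move=> U2.
have [->|U0] := eqVneq U set0.
  rewrite (_ : preimage _ = set0) ?outer_length0 ?diam_pow0 ?mule0//.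
  by rewrite -subset0 => u [].
rewrite /diam_pow (negbTE U0).
have : 0 <= diam U := diam_ge0 _.
case diamU : (diam U) U2 => [r| |]//; rewrite !lee_fin => r2 r0.
have distU x y : U x -> U y -> (mdist x y <= r)%R.
  by move=> Ux Uy; rewrite -lee_fin -diamU; exact: mdist_diam.
rewrite poweR_EFin -EFinM -mulrA -powRM//.
move: r0; rewrite le_eqVlt => /predU1P[/esym r00|r0]; last first.
  apply: outer_length_preimage_small; first by apply/andP; split; lra.
  by move=> x y Ux Uy; apply: (le_lt_trans (distU _ _ Ux Uy)); lra.
rewrite r00 in distU *.
move: (s0); rewrite le_eqVlt => /predU1P[s00|spos].
  have dist1 x y : U x -> U y -> (mdist x y < 1)%R.
    by move=> Ux Uy; apply: (le_lt_trans (distU _ _ Ux Uy)); lra.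
  have := @outer_length_preimage_small U 1 _ dist1.
  by rewrite ltr01 lexx -s00 !powRr0 => /(_ isT).
rewrite mulr0 powR0 ?gt_eqF// mulr0.
apply/lee_addgt0Pr => e e0; rewrite add0e.
pose r' := Num.min 1%R ((e / K) `^ s^-1)%R.
have r'0 : (0 < r')%R by rewrite lt_min ltr01 powR_gt0// divr_gt0.
have dist' x y : U x -> U y -> (mdist x y < r')%R.
  by move=> Ux Uy; apply: (le_lt_trans (distU _ _ Ux Uy)).
apply: (le_trans (@outer_length_preimage_small U r' _ dist')).
  by rewrite r'0 ge_min lexx.
rewrite lee_fin mulrC -ler_pdivlMr//.
apply: (@le_trans _ _ (((e / K) `^ s^-1) `^ s)%R).
  by apply: ge0_ler_powR; rewrite ?nnegrE ?powR_ge0 ?(ltW r'0)// ge_min lexx orbT.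
by rewrite -powRrM mulVf ?gt_eqF// powRr1// divr_ge0// ltW.
Qed.

(** Mass distribution principle, where the mass of a set of points is the outer
    length of its set of parameters. *)
Lemma hausdorff_measure_tree (A : set (torus R d)) :
  (forall u, (0 <= u < 1)%R -> A (point u)) -> hausdorff_measure s A != 0.
Proof.
move=> Au; have c0 : (0 < K * 2 `^ s)%R by rewrite mulr_gt0 ?powR_gt0.
apply: (@hausdorff_measure_neq0 _ _ _ _ 2^-1 (K * 2 `^ s)^-1%R).
- by rewrite invr_gt0.
- by rewrite invr_gt0.
move=> U Ud AU; rewrite -(@lee_pmul2l _ (K * 2 `^ s)%:E) ?lte_fin//.
rewrite -EFinM mulfV ?gt_eqF// -nneseriesZl; last by move=> *; exact: diam_pow_ge0.
apply: le_trans (tree_preimage_cover Au AU) _.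
apply: lee_nneseries => [j _ _|j _]; first exact: outer_length_ge0.
exact: outer_length_preimage_diam.
Qed.

End Hausdorff_lower_bound.
End tree_dimension.

(** * Packing measure of sets containing a dyadic tree *)

Lemma powR2_ge (R : realType) (x : R) : x <= 2 `^ x.
Proof.
have [x0|x0] := leP x 0; first by apply: (le_trans x0); rewrite powR_ge0.
apply: (le_trans (ltW (truncnS_gt _))).
apply: (@le_trans _ _ (2 `^ (Num.truncn x)%:R)).
  by rewrite powR_mulrn// -natrX ler_nat ltn_expl.
by apply: ler_powR; rewrite ?ler1n// truncn_le ltW.
Qed.

Lemma pigeonhole_card (I J : finType) (P : pred I) (f : I -> J) :
  (0 < #|J|)%N ->
  exists k, (#|P| <= #|J| * #|[pred i | P i && (f i == k)]|)%N.
Proof.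
move=> J0; apply/existsP; apply: contraT; rewrite negb_exists => /forallP Pk.
have : (\sum_(k : J) (#|J| * #|[pred i | P i && (f i == k)]|).+1 <=
        \sum_(k : J) #|P|)%N.
  by apply: leq_sum => k _; rewrite ltnNge Pk.
have e : (\sum_k #|[pred i | P i && (f i == k)]| = #|P|)%N.
  rewrite -sum1_card (partition_big f xpredT)//=.
  by apply: eq_bigr => k _; rewrite sum1_card.
under eq_bigr do rewrite -addn1.
rewrite big_split/= -big_distrr/= e !sum_nat_const muln1.
by rewrite -[leqRHS]addn0 leq_add2l leqNgt J0.
Qed.

Section packing_lower_bound.
Context {R : realType} {d : nat}.
Variables (free : pred nat) (h : nat -> code d -> 'I_d -> bool).
Implicit Types u v : R.
Local Notation point := (@tree_point R d free h).
Local Notation path := (@tree_path R d free h).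
Local Notation preimage := (@tree_preimage R d free h).
Local Notation rank := (rank free).
Variable s : R.
Hypothesis rank_large : forall (M : R) (N : nat),
  exists2 n, (N <= n)%N & M <= (d * rank n)%:R - s * n%:R.

Definition residue4 n (c : {ffun 'I_d -> 'I_(2 ^ n)}) : {ffun 'I_d -> 'I_4} :=
  [ffun i => inord (c i %% 4)].

(** Points of distinct cubes of generation [n] with the same residues modulo
    [4] are too far apart for balls of radius [2 ^- n] to meet. *)
Lemma residue4_separated n (c c' : {ffun 'I_d -> 'I_(2 ^ n)}) u v :
  (2 <= n)%N -> residue4 c = residue4 c' ->
  (forall i, path u n i = c i) -> (forall i, path v n i = c' i) ->
  mdist (point u) (point v) < 3%:R / 2 ^+ n -> c = c'.
Proof.
move=> n2 cc' uc vc /tree_path_near uv; apply/ffunP => i; apply: val_inj => /=.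
have [k] := uv i; rewrite uc vc ltr_norml.
have := congr1 (fun g : {ffun 'I_d -> 'I_4} => val (g i)) cc'.
rewrite /= !ffunE !inordK ?ltn_pmod//.
have := ltn_ord (c i); have := ltn_ord (c' i).
move: (c i : nat) (c' i : nat) => a b.
have -> : (2 ^ n = 4 * 2 ^ (n - 2))%N by rewrite -[4%N]/(2 ^ 2)%N -expnD subnKC.
set N := (2 ^ (n - 2))%N => bN aN ab kab.
have ea := divn_eq a 4; have eb := divn_eq b 4.
have [y ey] : exists y : int, y = N%:Z * k by exists (N%:Z * k).
have e : (a %/ 4)%N%:Z - (b %/ 4)%N%:Z + y = 0.
  have : (4 * N)%N%:Z * k = 4%:Z * y by rewrite ey PoszM mulrA.
  by move=> e4; move: kab; rewrite e4 => /andP[? ?]; lia.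
have k0 : k = 0 by nia.
by move: e; rewrite ey k0 mulr0; lia.
Qed.

Local Open Scope ereal_scope.

(** A set that receives a positive share of the parameters meets a positive
    fraction of the cubes of every generation, and one residue class modulo [4]
    retains a proportion [4 ^- d] of them: this gives arbitrarily fine packings
    by as many balls as cubes, up to a constant. *)
Lemma packing_premeasure_tree (U : set (torus R d)) :
  0 < outer_length (preimage U) -> packing_premeasure s U = +oo.
Proof.
move=> U0.
have U1 : outer_length (preimage U) <= 1.
  apply: (@le_trans _ _ (outer_length `[0%R, 1%R[%classic)).
    by apply: le_outer_length => u [u01 _]; rewrite /= in_itv.
  by rewrite outer_length_itv_co// subr0.
have [e e0 Ue] : exists2 e : R, (0 < e)%R & outer_length (preimage U) = e%:E.
  by move: U0 U1; case: outer_length => // r; rewrite lte_fin; exists r.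
apply/eqP; rewrite eq_le leey/=; apply: le_ereal_inf_tmp => _ [delta /= delta0 <-].
suff -> : packing_premeasure_delta s delta U = +oo by [].
apply: eq_infty => M.
(* [L] is the gain in the exponent that beats [M] and all the constants. *)
pose L : R := (`|M| * (4 ^ d)%:R / (e * 2 `^ s))%R.
have [n Nn nL] := rank_large L ((Num.truncn delta^-1).+2).
have n2 : (2 <= n)%N by apply: leq_trans Nn.
have nd : ((2 ^+ n)^-1 <= delta)%R.
  rewrite -[leRHS]invrK lef_pV2 ?posrE ?invr_gt0 ?exp2_gt0//.
  apply: ltW; apply: lt_trans (truncnS_gt _) _.
  by rewrite -natrX ltr_nat (leq_ltn_trans _ (ltn_expl n (ltnSn 1)))// ltnW.
pose T := {ffun 'I_d -> 'I_(2 ^ n)}.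
pose P : pred T := fun c => `[< exists u, preimage U u /\
  forall i, path u n i = c i >].
have eP : (e <= (2 ^+ (d * rank n))^-1 *+ #|P|)%R.
  rewrite -lee_fin -Ue.
  apply: (@outer_length_tree _ _ _ h _ P
     (fun c : T => [ffun i => val (c i)]) n) => [u []//|u Uu].
  exists [ffun i => Ordinal (tree_path_lt free h u n i)].
    by apply/asboolP; exists u; split => // i; rewrite ffunE.
  by apply/ffunP => i; rewrite !ffunE.
have [kappa Pkappa] := @pigeonhole_card _ _ P (@residue4 n)
  (ltac:(by rewrite card_ffun !card_ord expn_gt0)).
move: Pkappa; rewrite card_ffun !card_ord.
set Q := [pred c | _] => PQ.
have /choice[w wP] : forall c : T, exists u, P c ->
    preimage U u /\ forall i, path u n i = c i.
  move=> c; have [/asboolP[u uP]|nP] := boolP (P c); first by exists u.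
  by exists 0%R.
pose c0 : T := [ffun=> Ordinal (ltac:(by rewrite expn_gt0) : (0 < 2 ^ n)%N)].
pose c j := nth c0 (enum Q) j.
have cQ j : (j < #|Q|)%N -> Q (c j).
  by rewrite cardE => jQ; have := mem_nth c0 jQ; rewrite mem_enum.
apply: (@le_trans _ _ (\esum_(j in `I_#|Q|) ((2 * (2 ^+ n)^-1) `^ s)%:E)); last first.
  apply: ereal_sup_ubound; exists `I_#|Q|, (fun j => point (w (c j))),
    (fun=> (2 ^+ n)^-1)%R.
  split => //; split => [j /cQ/andP[Pj _]|j _|i j].
  - by have [[]] := wP _ Pj.
  - by rewrite invr_gt0 exp2_gt0.
  - move=> iQ jQ [z [zi zj]].
    have /andP[Pi /eqP ri] := cQ i iQ; have /andP[Pj /eqP rj] := cQ j jQ.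
    have [_ ci] := wP _ Pi; have [_ cj] := wP _ Pj.
    have : c i = c j.
      apply: (residue4_separated n2 _ ci cj); first by rewrite ri rj.
      apply: (le_lt_trans (metric_triangle _ z _)).
      rewrite (metric_sym z) (le_lt_trans (lerD zi zj))//.
      rewrite -{1 2}[((2 ^+ n)^-1)%R]mul1r -mulrDl ltr_pM2r ?invr_gt0 ?exp2_gt0//.
      lra.
    by move/eqP; rewrite nth_uniq ?enum_uniq -?cardE// => /eqP.
apply: esum_ge; exists `I_#|Q|.
  by split => //; exact: finite_II.
rewrite -(fsbig_ord _ _ (fun=> ((2 * (2 ^+ n)^-1) `^ s)%:E)) sumEFin.
rewrite lee_fin sumr_const card_ord.
have W0 := @exp2_gt0 R (d * rank n).
have s20 : (0 < e * 2 `^ s)%R by rewrite mulr_gt0 ?powR_gt0.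
have D0 : (0 < (4 ^ d)%:R :> R)%R by rewrite ltr0n expn_gt0.
have eQ : (e * 2 ^+ (d * rank n) <= (4 ^ d)%:R * #|Q|%:R)%R.
  rewrite -natrM -ler_pdivlMr// mulrC; apply: (le_trans eP).
  by rewrite -[leLHS]mulr_natr ler_wpM2l ?invr_ge0 ?(ltW W0)// ler_nat.
have ML : (`|M| * (4 ^ d)%:R <= 2 `^ L * (e * 2 `^ s))%R.
  by rewrite -ler_pdivrMr//; exact: powR2_ge.
have LW : (2 `^ L <= 2 ^+ (d * rank n) * 2 `^ (- (s * n%:R)))%R.
  rewrite -powR_mulrn// -powRD ?pnatr_eq0 ?implybT//.
  by apply: ler_powR => //; rewrite ler1n.
have -> : ((2 / 2 ^+ n) `^ s = 2 `^ s * 2 `^ (- (s * n%:R)) :> R)%R.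
  rewrite powRM ?invr_ge0 ?exprn_ge0//; congr (_ * _)%R.
  by rewrite -powR_invn// -powRrM mulNr mulrC.
rewrite -[leRHS]mulr_natr; apply: (le_trans (ler_norm _)).
rewrite -(ler_pM2r D0); apply: (le_trans ML).
apply: (@le_trans _ _ ((2 ^+ (d * rank n) * 2 `^ (- (s * n%:R))) * (e * 2 `^ s)))%R.
  by rewrite ler_wpM2r// ltW.
rewrite (_ : _ * _ = (2 `^ s * 2 `^ (- (s * n%:R))) * (e * 2 ^+ (d * rank n)))%R;
  last by ring.
have c0' : (0 <= 2 `^ s * 2 `^ (- (s * n%:R)) :> R)%R by rewrite mulr_ge0 ?powR_ge0.
apply: (le_trans (ler_wpM2l c0' eQ)).
by rewrite le_eqVlt; apply/orP; left; apply/eqP; ring.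
Qed.

(** By countable subadditivity some member of any countable cover receives a
    positive share of the parameters. *)
Lemma packing_measure_tree (A : set (torus R d)) :
  (forall u, (0 <= u < 1)%R -> A (point u)) -> packing_measure s A = +oo.
Proof.
move=> Au; apply/eqP; rewrite eq_le leey/=.
apply: le_ereal_inf_tmp => _ [U /= AU <-].
have [[j Uj]|/forallNP U0] :=
    pselect (exists j, 0 < outer_length (preimage (U j))).
  have ge0 k : 0 <= packing_premeasure s (U k).
    apply: le_ereal_inf_tmp => _ [delta delta0 <-]; apply: ereal_sup_ubound.
    exists set0, (fun=> tproj (fun=> 0%R)), (fun=> 0%R); split; last by rewrite esum_set0.
    by split => // i j' [].
  by rewrite (nneseries_pinfty _ _ (packing_premeasure_tree Uj)).
have := tree_preimage_cover Au AU; rewrite eseries0 ?lee_fin ?ler10// => k _ _.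
apply/eqP; rewrite eq_le outer_length_ge0 andbT leNgt.
by apply/negP; exact: U0.
Qed.

End packing_lower_bound.

(** * Upper bound for the packing dimension *)

Section packing_upper_bound.
Context {R : realType} {d : nat}.
Hypothesis d1 : (1 <= d)%N.
Local Open Scope ereal_scope.

Lemma cball_ocube (x : torus R d) (r : R) : (0 < r <= 1)%R ->
  exists n (c : code d), [/\ forall i, (c i < 2 ^ n)%N,
    ocube n c `<=` cball x r & (r <= 2 * d%:R / 2 ^+ n)%R].
Proof.
move=> /andP[r0 r1].
have dR : (1 <= d%:R :> R)%R by rewrite ler1n.
have [n nr rn] : exists2 n, (d%:R / 2 ^+ n <= r)%R & (r <= 2 * d%:R / 2 ^+ n)%R.
  have ex : exists n, (d%:R / 2 ^+ n <= r :> R)%R.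
    exists (Num.truncn (d%:R / r))%R; rewrite ler_pdivrMr ?exp2_gt0// mulrC.
    rewrite -ler_pdivrMr//; apply: ltW; apply: lt_le_trans (truncnS_gt _) _.
    by rewrite -natrX ler_nat ltn_expl.
  case: (ex_minnP ex) => -[|n] nr nmin; first by exists 0%N; rewrite // expr0; lra.
  exists n.+1 => //; apply: ltW; rewrite ltNge; apply/negP => h.
  have /nmin : (d%:R / 2 ^+ n <= r)%R.
    apply: le_trans h; rewrite exprS invfM mulrACA divff ?mul1r//.
  by rewrite ltnn.
have z0 := @exp2_gt0 R n.
have x0 i : (0 <= 2 ^+ n * tcoord x i)%R.
  by rewrite mulr_ge0 ?(ltW z0)//; case/andP: (tcoord_itv x i).
pose c : code d := [ffun i => Num.truncn (2 ^+ n * tcoord x i)].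
exists n, c; split => //.
  move=> i; rewrite ffunE truncn_lt_nat// natrX.
  by rewrite -[ltRHS]mulr1 ltr_pM2l//; case/andP: (tcoord_itv x i).
move=> y yc; apply: le_trans nr; rewrite -(tproj_tcoord x) -(tproj_tcoord y).
apply: mdist_tproj_le => i; have := yc i; have := truncn_itv (x0 i).
rewrite /c ffunE; move: (Num.truncn _) => k /andP[k1 k2] /andP[k3 k4].
rewrite -(ler_pM2r z0) mulVf ?gt_eqF// -[X in (_ * X)%R](gtr0_norm z0) -normrM.
rewrite ler_norml mulrBl; move: k2 k4; rewrite -[k.+1%:R]natr1 => k2 k4.
by apply/andP; split; lra.
Qed.

(** Disjoint balls contain disjoint dyadic cubes of comparable diameter, whose
    volumes add up to at most [1]. *)
Lemma packing_premeasure_delta_le (s delta : R) (A : set (torus R d)) :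
  (d%:R < s)%R -> (0 < delta <= 1)%R ->
  packing_premeasure_delta s delta A <=
  ((2 * delta) `^ (s - d%:R) * (4 * d%:R) ^+ d)%:E.
Proof.
move=> ds /andP[delta0 delta1].
apply: ge_ereal_sup => _ [D [x [r [[_ rD tD] ->]]]].
have /choice[n /choice[c nc]] : forall i, exists n (c : code d), D i ->
    [/\ forall j, (c j < 2 ^ n)%N, ocube n c `<=` cball (x i) (r i) &
        (r i <= 2 * d%:R / 2 ^+ n)%R].
  move=> i; have [/rD/andP[r0 rd]|nDi] := pselect (D i); last by exists 0%N, [ffun=> 0%N].
  have := @cball_ocube (x i) (r i).
  by rewrite r0 (le_trans rd delta1) => /(_ isT)[n [c nc]]; exists n, c.
set K : R := (_ * _ ^+ d)%R.
have K0 : (0 <= K)%R by rewrite mulr_ge0 ?powR_ge0// exprn_ge0.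
pose Q i : set (torus R d) := ocube (n i) (c i).
have mQ i : D i -> measurable (Q i).
  by move=> Di; apply: ocube_measurable; have [] := nc i Di.
apply: (@le_trans _ _ (\esum_(i in D) (K%:E * lebesgue_torus d (Q i)))).
  apply: le_esum => i Di; have [ci cQ ri] := nc i Di.
  have /andP[ri0 rid] := rD i Di.
  apply: (@le_trans _ _ (K%:E * ((2 ^+ (n i * d))^-1)%:E)); last first.
    by rewrite lee_wpmul2l ?lee_fin//; exact: lebesgue_torus_ocube.
  rewrite -EFinM lee_fin.
  have -> : ((2 * r i) `^ s = (2 * r i) `^ (s - d%:R) * (2 * r i) ^+ d)%R.
    rewrite -powR_mulrn ?mulr_ge0 ?(ltW ri0)// -powRD ?subrK//.
    by rewrite mulf_neq0 ?implybT// gt_eqF.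
  rewrite /K exprM -exprVn -mulrA -exprMn ler_pM ?powR_ge0//.
  - by rewrite exprn_ge0// mulr_ge0// ltW.
  - apply: ge0_ler_powR; rewrite ?nnegrE ?subr_ge0 ?mulr_ge0 ?(ltW ds) ?(ltW ri0)
      ?(ltW delta0)//.
    by rewrite ler_pM2l.
  - rewrite lerXn2r ?nnegrE ?mulr_ge0 ?invr_ge0 ?exprn_ge0 ?(ltW ri0)//.
    by rewrite (_ : 4 * d%:R / _ = 2 * (2 * d%:R / 2 ^+ n i))%R ?ler_pM2l//; ring.
rewrite (_ : \esum_(i in D) _ = K%:E * lebesgue_torus d (\bigcup_(i in D) Q i)).
  rewrite -[leRHS]mule1 lee_wpmul2l// probability_le1//.
  by apply: bigcup_measurable => i; exact: mQ.
rewrite measure_bigcup//; last first.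
  apply/trivIsetP => i j Di Dj ij; rewrite -subset0 => y [Qi Qj].
  move/trivIsetP : tD => /(_ i j Di Dj ij); rewrite -subset0 => /(_ y); apply; split.
    by have [_ + _] := nc i Di; exact.
  by have [_ + _] := nc j Dj; exact.
rewrite -nneseriesZl; last by [].
rewrite nneseries_esum; last by move=> i _; rewrite mule_ge0.
by congr (\esum_(i in _) _); apply/seteqP; split => i /=; rewrite ?inE.
Qed.

Lemma packing_premeasure_eq0 (s : R) (A : set (torus R d)) : (d%:R < s)%R ->
  packing_premeasure s A = 0.
Proof.
move=> ds; apply/eqP; rewrite eq_le; apply/andP; split; last first.
  apply: le_ereal_inf_tmp => _ [delta delta0 <-]; apply: ereal_sup_ubound.
  exists set0, (fun=> tproj (fun=> 0%R)), (fun=> 0%R); split; last by rewrite esum_set0.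
  by split => // i j [].
apply/lee_addgt0Pr => e e0; rewrite add0e.
have sd0 : (0 < s - d%:R)%R by rewrite subr_gt0.
have D0 : (0 < (4 * d%:R) ^+ d :> R)%R by rewrite exprn_gt0// mulr_gt0// ltr0n.
pose eta := ((e / (4 * d%:R) ^+ d) `^ (s - d%:R)^-1)%R.
have eta0 : (0 < eta)%R by rewrite powR_gt0// divr_gt0.
pose delta : R := Num.min 1%R (eta / 2)%R.
have delta0 : (0 < delta)%R by rewrite lt_min ltr01 divr_gt0.
apply: (@le_trans _ _ (packing_premeasure_delta s delta A)).
  by apply: ereal_inf_lbound; exists delta.
apply: (le_trans (packing_premeasure_delta_le _ ds _)).
  by rewrite delta0 ge_min lexx.
rewrite lee_fin -ler_pdivlMr//.
apply: (@le_trans _ _ (eta `^ (s - d%:R))%R).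
  apply: ge0_ler_powR; rewrite ?nnegrE ?mulr_ge0 ?(ltW delta0) ?(ltW eta0) ?(ltW sd0)//.
  by rewrite mulrC -ler_pdivlMr// ge_min lexx orbT.
by rewrite /eta -powRrM mulVf ?gt_eqF// powRr1// divr_ge0// ltW.
Qed.

Lemma packing_dim_le (A : set (torus R d)) : packing_dim A <= d%:R%:E.
Proof.
apply/lee_addgt0Pr => e e0; apply: ereal_inf_lbound; exists (d%:R + e)%R => //.
split; first by rewrite addr_ge0// ltW.
have ds : (d%:R < d%:R + e)%R by rewrite ltrDl.
apply/eqP; rewrite eq_le; apply/andP; split; last first.
  apply: le_ereal_inf_tmp => _ [U _ <-].
  by apply: nneseries_ge0 => k _ _; rewrite packing_premeasure_eq0.
apply: ereal_inf_lbound; exists (fun=> A); first by move=> x Ax; exists 0%N.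
by rewrite eseries0// => k _ _; exact: packing_premeasure_eq0.
Qed.

End packing_upper_bound.

(** * The generations of the construction *)

Section rank_bounds.
Variable free : pred nat.

Lemma rank_cat m n : (m <= n)%N ->
  rank free n = (rank free m + \sum_(m <= j < n) free j)%N.
Proof. by move=> mn; rewrite /rank (big_cat_nat (leq0n m) mn). Qed.

Lemma rank_le m n : (m <= n)%N -> (rank free n <= rank free m + (n - m))%N.
Proof.
move=> mn; rewrite (rank_cat mn) leq_add2l.
rewrite -[X in (_ <= X)%N]muln1 -sum_nat_const_nat.
by apply: leq_sum => j _; case: free.
Qed.

Lemma le_rank m n : (m <= n)%N -> (rank free m <= rank free n)%N.
Proof. by move=> mn; rewrite (rank_cat mn) leq_addr. Qed.

Lemma rank_full m n : (m <= n)%N -> (forall j, (m <= j < n)%N -> free j) ->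
  rank free n = (rank free m + (n - m))%N.
Proof.
move=> mn mnf; rewrite (rank_cat mn); congr addn.
rewrite -[RHS]muln1 -sum_nat_const_nat; apply: eq_big_nat => j jmn.
by rewrite mnf.
Qed.

End rank_bounds.

Section scales.
Context {R : realType}.

(** Factorials make the generations up to the start of a stretch negligible
    before its end is reached. *)
Definition full_start k : nat := ((2 * k)`!)%N.
Definition full_end k : nat := ((2 * k).+1`!)%N.
Local Notation q := full_start.
Local Notation p := full_end.

Lemma full_endE k : p k = ((2 * k).+1 * q k)%N. Proof. by rewrite /p factS. Qed.

Lemma full_startS k : q k.+1 = ((2 * k).+2 * p k)%N.
Proof. by rewrite /q (_ : 2 * k.+1 = (2 * k).+2)%N ?factS//; lia. Qed.

Lemma full_start_gt0 k : (0 < q k)%N. Proof. exact: fact_gt0. Qed.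

Lemma full_start_le_end k : (q k <= p k)%N.
Proof. by rewrite full_endE leq_pmull. Qed.

Lemma full_end_le_start k : (p k <= q k.+1)%N.
Proof. by rewrite full_startS leq_pmull. Qed.

Lemma full_start_mono j k : (j <= k)%N -> (q j <= q k)%N.
Proof. by move=> jk; apply: leq_fact; rewrite leq_mul2l. Qed.

Lemma full_end_mono j k : (j <= k)%N -> (p j <= p k)%N.
Proof. by move=> jk; apply: leq_fact; rewrite ltnS leq_mul2l. Qed.

Lemma full_end_lt_start j k : (j < k)%N -> (p j <= q k)%N.
Proof. by move=> jk; apply: leq_trans (full_end_le_start j) (full_start_mono jk). Qed.

Lemma leq_full_start k : (k <= q k)%N.
Proof.
elim: k => // k ih; rewrite full_startS.
have := full_start_le_end k; have := full_start_gt0 k; nia.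
Qed.

Variables (tau beta : R).

(** The positions where [n * tau] crosses an integer have density [tau] with a
    bounded error, since their number telescopes. *)
Definition sturmian n : bool :=
  Num.truncn (n.+1%:R * tau) != Num.truncn (n%:R * tau).

Definition in_full n : bool := `[< exists k, (q k <= n < p k)%N >].

Definition digit_free n : bool := in_full n || sturmian n.

(** About [beta * full_end k], but never before the positions become free. *)
Definition hit_start k : nat := maxn (q k) (Num.truncn (beta * (p k)%:R)).
Local Notation a := hit_start.

Definition in_hit n : bool := `[< exists k, (a k <= n < p k)%N >].

Definition unhit_free n : bool := digit_free n && ~~ in_hit n.

Lemma start_le_hit k : (q k <= a k)%N. Proof. exact: leq_maxl. Qed.

Lemma hit_start_ge k : beta * (p k)%:R <= (a k)%:R + 1.
Proof.
apply: (le_trans (ltW (truncnS_gt _))).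
by rewrite -natr1 lerD2r ler_nat leq_maxr.
Qed.

Lemma block_unique j k n :
  (q j <= n < p j)%N -> (q k <= n < q k.+1)%N -> j = k.
Proof.
move=> /andP[qj pj] /andP[qk pk].
have [jk|kj|//] := ltngtP j k.
  by have := full_end_lt_start jk; lia.
by have := full_start_mono kj; lia.
Qed.

Lemma in_full_between k n : (p k <= n < q k.+1)%N -> in_full n = false.
Proof.
move=> /andP[pn nq]; apply/asboolP => -[j jn].
have jk : j = k.
  by apply: (block_unique jn); rewrite nq (leq_trans (full_start_le_end k)).
by move: jn; rewrite jk; lia.
Qed.

Lemma in_hit_full k n : (q k <= n < q k.+1)%N ->
  in_hit n = (a k <= n < p k)%N.
Proof.
move=> kn; apply/asboolP/idP => [[j jn]|kn']; last by exists k.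
have -> // : k = j; apply/esym/(block_unique _ kn).
by have := start_le_hit j; lia.
Qed.

Lemma unhit_free_between k n : (p k <= n < q k.+1)%N ->
  unhit_free n = sturmian n.
Proof.
move=> pq; rewrite /unhit_free /digit_free (in_full_between pq)/= (@in_hit_full k).
  by case/andP: pq => pn _; rewrite [(n < _)%N]ltnNge pn andbF andbT.
by case/andP: pq => pn ->; rewrite (leq_trans (full_start_le_end k)).
Qed.

Lemma digit_free_rank_end k : (p k)%:R - (q k)%:R <= (rank digit_free (p k))%:R :> R.
Proof.
have qp := full_start_le_end k.
rewrite (rank_full qp) => [|j jk].
  by rewrite natrD natrB// lerDr.
by apply/orP; left; apply/asboolP; exists k.
Qed.

Hypothesis tau01 : 0 <= tau <= 1.
Hypothesis beta01 : 0 <= beta <= 1.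

Lemma sturmian_sum m n : (m <= n)%N ->
  (Num.truncn (m%:R * tau) + \sum_(m <= j < n) sturmian j =
   Num.truncn (n%:R * tau))%N.
Proof.
have /andP[t0 t1] := tau01.
elim: n => [|n ih]; first by rewrite leqn0 => /eqP ->; rewrite big_geq// addn0.
rewrite leq_eqVlt => /predU1P[->|]; first by rewrite big_geq// addn0.
rewrite ltnS => mn; rewrite big_nat_recr//= addnA ih// /sturmian.
have n0 : 0 <= n%:R * tau by rewrite mulr_ge0.
have := truncn_itv n0; set k := Num.truncn _ => /andP[k1 k2].
have [//|kn] := eqVneq (Num.truncn (n.+1%:R * tau)) k; first by rewrite addn0.
rewrite addn1; apply/esym/truncn_def.
have n1 : 0 <= n.+1%:R * tau by rewrite mulr_ge0.
have : (k < Num.truncn (n.+1%:R * tau))%N.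
  by rewrite ltn_neqAle eq_sym kn le_truncn// ler_wpM2r// ler_nat.
rewrite truncn_ge_nat// => -> /=.
rewrite -[n.+1%:R]natr1 mulrDl mul1r -[k.+2%:R]natr1; lra.
Qed.

Lemma hit_start_le k : (a k <= p k)%N.
Proof.
have /andP[b0 b1] := beta01.
rewrite geq_max full_start_le_end/= truncn_le_nat.
rewrite (@le_lt_trans _ _ (p k)%:R) ?ltr_nat//.
by rewrite -[leRHS]mul1r ler_wpM2r.
Qed.

Lemma hit_start_le_sum k : (a k)%:R <= beta * (p k)%:R + (q k)%:R.
Proof.
have /andP[b0 b1] := beta01.
have bp0 : 0 <= beta * (p k)%:R by rewrite mulr_ge0.
rewrite /a /maxn; case: ifP => _; last by rewrite lerDr.
by apply: (le_trans (_ : _ <= beta * (p k)%:R)); rewrite ?lerDl// truncn_le.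
Qed.

Lemma unhit_free_before k n : (q k <= n < a k)%N -> unhit_free n.
Proof.
move=> /andP[qn na]; have np := leq_trans na (hit_start_le k).
have nq := leq_trans np (full_end_le_start k).
rewrite /unhit_free (@in_hit_full k) ?qn ?nq// leqNgt na/= andbT.
by apply/orP; left; apply/asboolP; exists k; rewrite qn.
Qed.

Lemma digit_free_rank_start k :
  (rank digit_free (q k.+1))%:R <= (p k)%:R + tau * (q k.+1)%:R.
Proof.
have pq := full_end_le_start k.
rewrite (rank_cat _ pq) natrD; apply: lerD.
  by rewrite ler_nat (leq_trans (rank_le _ (leq0n _)))// /rank big_geq// subn0.
rewrite (eq_big_nat _ _ (F2 := fun j => nat_of_bool (sturmian j))); last first.
  by move=> j jk; rewrite /digit_free (in_full_between jk).
apply: (@le_trans _ _ (Num.truncn ((q k.+1)%:R * tau))%:R).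
  by rewrite -(sturmian_sum pq) ler_nat leq_addl.
have /andP[t0 t1] := tau01.
by rewrite mulrC truncn_le mulr_ge0.
Qed.

Let gam := Num.min beta tau.

(** At the start of the [k]-th hit at least [beta * p k - 1 - q k] free positions
    have occurred, enough to last until [p k]. From then on they come at rate
    [tau] until [q k.+1] and at rate [1] until the next hit, so the count stays
    above the line of slope [min beta tau], up to [q k + 2]. *)
Lemma unhit_free_rank n : (0 < n)%N -> exists k,
  gam * n%:R - 2 - (q k)%:R <= (rank unhit_free n)%:R /\
  beta * (p k)%:R <= n%:R + 1.
Proof.
move=> n0; have /andP[t0 t1] := tau01; have /andP[b0 b1] := beta01.
have gb : gam <= beta by rewrite ge_min lexx.
have gt : gam <= tau by rewrite ge_min lexx orbT.
have g0 : 0 <= gam by rewrite le_min b0.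
have atA k : (a k)%:R - (q k)%:R <= (rank unhit_free (a k))%:R :> R.
  rewrite (rank_full (start_le_hit k)) => [|j jk]; last exact: unhit_free_before jk.
  by rewrite natrD natrB ?start_le_hit// lerDr.
have atP k m : (a k <= m)%N -> beta * (p k)%:R - 1 - (q k)%:R <=
    (rank unhit_free m)%:R.
  move=> am; apply: (@le_trans _ _ (rank unhit_free (a k))%:R); last first.
    by rewrite ler_nat le_rank.
  have := atA k; have := hit_start_ge k; lra.
have afterP k m : (p k <= m <= q k.+1)%N ->
    gam * m%:R - 2 - (q k)%:R <= (rank unhit_free m)%:R.
  move=> /andP[pm mq]; rewrite (rank_cat _ pm) natrD.
  rewrite (eq_big_nat _ _ (F2 := fun j => nat_of_bool (sturmian j))); last first.
    by move=> j /andP[pj jm]; rewrite (@unhit_free_between k)// pj (leq_trans jm).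
  have := atP k (p k) (hit_start_le k).
  have pt0 : 0 <= (p k)%:R * tau by rewrite mulr_ge0.
  have := truncnS_gt (m%:R * tau); rewrite -natr1 -(sturmian_sum pm) natrD.
  have := truncn_le ((p k)%:R * tau); rewrite pt0.
  have pmR : (p k)%:R <= m%:R :> R by rewrite ler_nat.
  set s := (\sum_(_ <= _ < _) _)%N; set t := Num.truncn _.
  have : gam * (p k)%:R <= beta * (p k)%:R by rewrite ler_wpM2r.
  have : gam * (m%:R - (p k)%:R) <= tau * (m%:R - (p k)%:R).
    by rewrite ler_wpM2r// subr_ge0.
  rewrite !mulrBr [m%:R * _]mulrC [(p k)%:R * _]mulrC; lra.
have [k kn] : exists k, (q k <= n < q k.+1)%N.
  have ex : exists k, (n < q k)%N by exists n.+1; exact: leq_full_start.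
  case: (ex_minnP ex) => -[|k] nk kmin; first by move: nk; rewrite /q fact0; lia.
  exists k; rewrite nk andbT leqNgt; apply/negP => /kmin; lia.
have /andP[qn nq] := kn.
have [na|an] := ltnP n (a k).
  case: k kn qn nq na => [|k] kn qn nq na.
    have := hit_start_le 0; rewrite /p !factS fact0; lia.
  exists k; have qn' : (q k.+1)%:R <= n%:R :> R by rewrite ler_nat.
  have pq' : (p k)%:R <= (q k.+1)%:R :> R by rewrite ler_nat full_end_le_start.
  split; last by have : beta * (p k)%:R <= (p k)%:R; [rewrite ler_piMl|lra].
  rewrite (rank_full qn) => [|j /andP[qj jn]]; last first.
    by apply: (@unhit_free_before k.+1); rewrite qj (ltn_trans jn).
  rewrite natrD natrB//.
  have := afterP k (q k.+1); rewrite leqnn full_end_le_start => /(_ isT).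
  have : gam * (n%:R - (q k.+1)%:R) <= n%:R - (q k.+1)%:R.
    by rewrite ler_piMl ?subr_ge0// (le_trans gb).
  rewrite mulrBr; lra.
exists k; have an' : (a k)%:R <= n%:R :> R by rewrite ler_nat.
split; last by have := hit_start_ge k; lra.
have [np|pn] := ltnP n (p k); last by apply: afterP; rewrite pn ltnW.
have := atP k n an; have : gam * n%:R <= beta * (p k)%:R.
  by apply: ler_pM => //; rewrite ler_nat ltnW.
lra.
Qed.

(** The relative length [full_start k / full_end k] tends to 0, which makes
    the error term of [unhit_free_rank] negligible. *)
Lemma unhit_free_rank_ge g : 0 <= g < gam ->
  exists C, forall n, g * n%:R - C <= (rank unhit_free n)%:R.
Proof.
move=> /andP[g0 ggam].
have b0 : 0 < beta.
  by apply: (le_lt_trans g0); apply: (lt_le_trans ggam); rewrite ge_min lexx.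
pose e := gam - g; have e0 : 0 < e by rewrite subr_gt0.
pose K := (Num.truncn (beta * e)^-1).+1.
exists (2 + e + (q K)%:R) => n.
have [->|n0] := posnP n.
  have := ler0n R (q K); have := ler0n R (rank unhit_free 0); rewrite mulr0; lra.
have [k [nk kn]] := unhit_free_rank n0.
apply: le_trans nk.
have n0R : 0 <= n%:R :> R by [].
have qK0 : 0 <= (q K)%:R :> R by [].
have [kK|Kk] := leqP k K.
  have : (q k)%:R <= (q K)%:R :> R by rewrite ler_nat full_start_mono.
  have : g * n%:R <= gam * n%:R by rewrite ler_wpM2r// ltW.
  lra.
suff : (q k)%:R <= e * (n%:R + 1) by rewrite /e; lra.
have be : 0 < beta * e by rewrite mulr_gt0.
have kR : (beta * e)^-1 <= (2 * k).+1%:R.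
  apply: (le_trans (ltW (truncnS_gt _))); rewrite -/K ler_nat; lia.
move: kn; rewrite full_endE natrM mulrA => kn.
have : 1 <= beta * (2 * k).+1%:R * e.
  by rewrite mulrAC -ler_pdivrMl// mulr1.
move: kn; set w := beta * _ => kn ew.
have w0 : 0 <= w by rewrite mulr_ge0// ltW.
have : e * (w * (q k)%:R) <= e * (n%:R + 1) by rewrite ler_pM2l.
have : 0 <= (q k)%:R :> R by [].
nra.
Qed.

End scales.

(** * Sets defined by their free binary digits *)

Section digit_set.
Context {R : realType} {d : nat}.
Variable free : pred nat.

Definition child (c : code d) (e : {ffun 'I_d -> bool}) : code d :=
  [ffun i => (c i).*2 + e i]%N.

Fixpoint digit_codes n : seq (code d) :=
  if n is m.+1 then
    if free m then [seq child c e | c <- digit_codes m, e <- enum {ffun 'I_d -> bool}]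
    else [seq child c [ffun=> false] | c <- digit_codes m]
  else [:: [ffun=> 0%N]].

Lemma size_digit_codes n : size (digit_codes n) = (2 ^ (d * rank free n))%N.
Proof.
elim: n => [|n ih]; first by rewrite /rank big_geq// muln0.
rewrite rankS mulnDr expnD -ih /=; case: (free n); last first.
  by rewrite size_map muln0 muln1.
by rewrite size_allpairs -cardE card_ffun card_bool card_ord muln1.
Qed.

(** Balls around the corners stand for closed cubes: this makes the set closed
    without any discussion of the faces of the cubes on the torus. *)
Definition digit_set : set (torus R d) :=
  \bigcap_n \bigcup_(c in [set` digit_codes n]) cball (corner n c) (d%:R / 2 ^+ n).

Lemma cball_closed (x : torus R d) (r : R) : closed (cball x r).
Proof.
rewrite (_ : cball x r = ~` [set y | r < mdist x y]); last first.
  by apply/seteqP; split => y /=; rewrite /cball/= leNgt => /negP.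
apply: open_closedC; rewrite openE => y /= ry.
apply/nbhs_ballP; exists (mdist x y - r); first by rewrite /= subr_gt0.
move=> z; rewrite ballEmdist/= => yz.
have := metric_triangle x z y; rewrite (metric_sym z); lra.
Qed.

Lemma digit_set_closed : closed digit_set.
Proof.
apply: closed_bigI => n _; apply: closed_bigcup => [|c _].
  exact: finite_seq.
exact: cball_closed.
Qed.

Lemma tree_path_digit_codes (free' : pred nat) (h : nat -> code d -> 'I_d -> bool)
    (u : R) n :
  (forall m, free' m -> free m) -> (forall m c i, h m c i -> free m) ->
  tree_path free' h u n \in digit_codes n.
Proof.
move=> f'f hf; elim: n => [|n ih]; first by rewrite inE.
rewrite /=; case: ifP => fn; last first.
  apply/mapP; exists (tree_path free' h u n) => //; apply/ffunP => i.
  rewrite !ffunE addn0; have [/f'f|_] := ifP; first by rewrite fn.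
  have := @hf n (tree_path free' h u n) i.
  by case: (h n _ i) => [/(_ isT)|]; rewrite ?fn ?addn0.
apply/allpairsP; exists (tree_path free' h u n, [ffun i : 'I_d => if free' n
  then bit u (d * rank free' n + i) else h n (tree_path free' h u n) i]).
split => //=; first by rewrite mem_enum.
by apply/ffunP => i; rewrite !ffunE.
Qed.

Lemma tree_point_digit_set (free' : pred nat) (h : nat -> code d -> 'I_d -> bool)
    (u : R) :
  (forall m, free' m -> free m) -> (forall m c i, h m c i -> free m) ->
  digit_set (tree_point free' h u).
Proof.
move=> f'f hf n _; exists (tree_path free' h u n).
  exact: tree_path_digit_codes.
by apply: dyadic_lim_corner => m i; exact: tree_path_half.
Qed.

Local Open Scope ereal_scope.

(** At a generation [n] with few free positions, the [2 ^ (d * rank free n)]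
    defining balls form an economical cover. *)
Lemma hausdorff_measure_digit_set (s : R) : (0 <= s)%R ->
  (forall (M : R) N, exists2 n, (N <= n)%N & (M <= s * n%:R - (d * rank free n)%:R)%R) ->
  hausdorff_measure s digit_set = 0.
Proof.
move=> s0 rank_small; apply: hausdorff_measure_eq0 => delta e delta0 e0.
pose D : R := (2 * d%:R + 1)%R.
have D0 : (0 < D)%R by rewrite ltr_wpDl// mulr_ge0.
pose L : R := (D `^ s / e)%R.
have [n Nn nL] := rank_small L (Num.truncn (D / delta)%R).+1.
have nD : (D / 2 ^+ n <= delta)%R.
  rewrite ler_pdivrMr ?exp2_gt0// mulrC -ler_pdivrMr//.
  apply: ltW; apply: lt_le_trans (truncnS_gt _) _.
  by rewrite -natrX ler_nat (leq_trans Nn)// ltnW// ltn_expl.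
pose B (c : code d) : set (torus R d) := cball (corner n c) (d%:R / 2 ^+ n).
pose U j := nth set0 [seq B c | c <- digit_codes n] j.
have r0 : (0 <= d%:R / 2 ^+ n :> R)%R by rewrite divr_ge0// exprn_ge0.
have Dn0 : (0 <= D / 2 ^+ n)%R by rewrite divr_ge0// ?exprn_ge0// ltW.
have UD j : diam (U j) <= (D / 2 ^+ n)%:E.
  have [jn|nj] := ltnP j (size (digit_codes n)); last first.
    by rewrite /U nth_default ?size_map//; apply: diam_le => // x y [].
  rewrite /U (nth_map [ffun=> 0%N])//; apply: (le_trans (diam_cball _ r0)).
  by rewrite lee_fin mulrA ler_pM2r ?invr_gt0 ?exp2_gt0// lerDl.
exists U; split.
- by move=> j; apply: (le_trans (UD j)); rewrite lee_fin.
- move=> x /(_ n I)[c cn xc]; exists (index c (digit_codes n)) => //.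
  by rewrite /U (nth_map [ffun=> 0%N]) ?index_mem// nth_index.
rewrite (nneseries_split 0 (size (digit_codes n))) => [|k _]; last exact: diam_pow_ge0.
rewrite [X in _ + X]eseries0 ?adde0 => [|j nj _]; last first.
  by rewrite /U nth_default ?size_map ?diam_pow0//.
apply: (@le_trans _ _ (\sum_(0 <= j < 0 + size (digit_codes n)) ((D / 2 ^+ n) `^ s)%:E)).
  by apply: lee_sum => j _; exact: diam_pow_le.
rewrite sumEFin lee_fin sumr_const_nat add0n subn0 size_digit_codes.
rewrite -[leLHS]mulr_natr natrX powRM ?invr_ge0 ?exprn_ge0 ?(ltW D0)//.
have -> : (((2 ^+ n)^-1) `^ s = 2 `^ (- (s * n%:R)) :> R)%R.
  by rewrite -powR_invn// -powRrM mulNr mulrC.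
rewrite -mulrA -powR_mulrn// -powRD ?pnatr_eq0 ?implybT//.
apply: (@le_trans _ _ (D `^ s * 2 `^ (- L)))%R.
  by rewrite ler_wpM2l ?powR_ge0// ler_powR ?ler1n//; lra.
rewrite powRN ler_pdivrMr ?powR_gt0// mulrC -ler_pdivrMr//.
exact: powR2_ge.
Qed.

End digit_set.

(** * Radii constant on consecutive blocks *)

Section blocks.
Variable N : nat -> nat.
Hypothesis N_gt0 : forall k, (0 < N k)%N.

Definition block_start k := (\sum_(0 <= j < k) N j)%N.

Lemma block_startS k : block_start k.+1 = (block_start k + N k)%N.
Proof. by rewrite /block_start big_nat_recr. Qed.

Lemma leq_block_start k : (k <= block_start k)%N.
Proof. by elim: k => // k ih; rewrite block_startS; have := N_gt0 k; lia. Qed.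

Lemma block_start_mono j k : (j <= k)%N -> (block_start j <= block_start k)%N.
Proof.
by elim: k => [|k ih]; [rewrite leqn0 => /eqP ->|
  rewrite leq_eqVlt => /predU1P[->//|/ih]; rewrite block_startS; lia].
Qed.

Lemma block_ex n : exists k, (n < block_start k.+1)%N.
Proof. by exists n; exact: leq_block_start. Qed.

Definition block n := ex_minn (block_ex n).

Lemma block_eq n k : (block_start k <= n < block_start k.+1)%N -> block n = k.
Proof.
move=> /andP[kn nk]; rewrite /block; case: ex_minnP => j nj jmin.
apply/eqP; rewrite eqn_leq (jmin _ nk)/= leqNgt; apply/negP => jk.
by have := block_start_mono jk; lia.
Qed.

Lemma block_mono m n : (m <= n)%N -> (block m <= block n)%N.
Proof.
move=> mn; rewrite /block; case: ex_minnP => j mj; apply.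
by case: ex_minnP => k nk _; exact: leq_ltn_trans nk.
Qed.

Lemma block_sum (R : realType) (f : nat -> R) K :
  \sum_(0 <= n < block_start K) f (block n) = \sum_(0 <= k < K) f k *+ N k.
Proof.
elim: K => [|K ih]; first by rewrite /block_start !big_geq.
rewrite [in RHS]big_nat_recr//= -ih.
rewrite (@big_cat_nat _ _ _ (block_start K))//=; last exact: block_start_mono.
congr (_ + _); rewrite (eq_big_nat _ _ (F2 := fun=> f K)); last first.
  by move=> n /block_eq ->.
by rewrite sumr_const_nat block_startS addKn.
Qed.

End blocks.

Section radii.
Context {R : realType} {d : nat}.
Hypothesis d1 : (1 <= d)%N.
Variable beta : R.
Hypothesis beta01 : 0 <= beta <= 1.

Local Notation q := full_start.
Local Notation p := full_end.
Local Notation a := (hit_start beta).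

(** There are [2 ^ (d * a k)] dyadic cubes of generation [a k]; the logarithmic
    factor is what as many random points need to hit them all with a probability
    of failure at most [2 ^- k]. *)
Definition block_size k : nat := (2 ^ (d * a k) * (d.+1 * p k))%N.

Lemma block_size_gt0 k : (0 < block_size k)%N.
Proof. by rewrite !muln_gt0 expn_gt0 fact_gt0. Qed.

Definition block_length k : R := 2 * (d%:R / 2 ^+ p k).

Definition radii n : R := block_length (block block_size_gt0 n).

Let dR : 0 < d%:R :> R. Proof. by rewrite ltr0n. Qed.

Lemma block_length_gt0 k : 0 < block_length k.
Proof. by rewrite mulr_gt0// divr_gt0// exp2_gt0. Qed.

Lemma radii_gt0 n : 0 < radii n. Proof. exact: block_length_gt0. Qed.

Lemma radii_homo : {homo radii : m n / (m <= n)%N >-> n <= m}.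
Proof.
move=> m n /(block_mono block_size_gt0) mn; rewrite /radii /block_length.
rewrite ler_pM2l// ler_pM2l// lef_pV2 ?posrE ?exp2_gt0//.
by rewrite ler_weXn2l ?ler1n// full_end_mono.
Qed.

Lemma block_length_powR k s :
  block_length k `^ s = (2 * d%:R) `^ s * 2 `^ (- (s * (p k)%:R)).
Proof.
rewrite /block_length mulrA [LHS]powRM ?mulr_ge0 ?invr_ge0 ?exprn_ge0//.
by rewrite -powR_invn// -powRrM mulNr [(s * _)%R]mulrC.
Qed.

Local Open Scope ereal_scope.

(** At the critical exponent every block contributes at least the same positive
    constant. *)
Lemma radii_series_pinfty :
  \sum_(0 <= n <oo) (radii n `^ (beta * d%:R))%:E = +oo.
Proof.
set al := (beta * d%:R)%R.
have /andP[b0 b1] := beta01.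
pose c : R := ((2 * d%:R) `^ al * 2 `^ (- d%:R))%R.
have c0 : (0 < c)%R by rewrite mulr_gt0 ?powR_gt0// mulr_gt0.
have ck k : (c <= block_length k `^ al *+ block_size k)%R.
  rewrite -mulr_natr block_length_powR /c -mulrA ler_wpM2l ?powR_ge0//.
  apply: (@le_trans _ _ (2 `^ (- (al * (p k)%:R)) * (2 ^ (d * a k))%:R)%R).
    rewrite natrX -powR_mulrn// -powRD ?pnatr_eq0 ?implybT//.
    apply: ler_powR; first by rewrite ler1n.
    have := @hit_start_ge R beta k; rewrite natrM /al -(ler_pM2l dR); lra.
  rewrite ler_wpM2l ?powR_ge0// ler_nat /block_size leq_pmulr//.
  by rewrite muln_gt0 fact_gt0.
apply: eq_infty => M.
pose K := (Num.truncn (M / c)%R).+1.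
apply: (@le_trans _ _ (\sum_(0 <= n < block_start block_size K) (radii n `^ al)%:E)).
  rewrite sumEFin lee_fin (block_sum block_size_gt0 (fun k => block_length k `^ al)%R).
  apply: (@le_trans _ _ (\sum_(0 <= k < K) c)%R); last exact: ler_sum.
  rewrite sumr_const_nat subn0 -[leRHS]mulr_natl -ler_pdivrMr//.
  exact: ltW (truncnS_gt _).
by apply: nneseries_lim_ge => n _; rewrite lee_fin powR_ge0.
Qed.

(** Above the critical exponent the contributions of the blocks are dominated by
    a geometric sequence: the logarithmic factor and [q k], the possible excess of
    [a k] over [beta * p k], are absorbed by a part of the gap [e]. *)
Lemma radii_series_lty (s : R) : (beta * d%:R < s)%R ->
  \sum_(0 <= n <oo) (radii n `^ s)%:E < +oo.
Proof.
move=> als; pose e := (s - beta * d%:R)%R.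
have /andP[b0 b1] := beta01.
have e0 : (0 < e)%R by rewrite subr_gt0.
pose K := (Num.truncn (d%:R / e)%R).+1.
pose z : R := (2 `^ (- (e / 4)))%R.
have z1 : (z < 1)%R.
  rewrite /z powRN invf_lt1 ?powR_gt0//.
  apply: (@lt_le_trans _ _ (1 + e / 4 * ln 2)%R).
    by rewrite ltrDl mulr_gt0 ?ln_gt0 ?ltr1n// divr_gt0.
  by rewrite /powR pnatr_eq0/= expR_ge1Dx.
have z0 : (0 < z)%R by exact: powR_gt0.
pose C : R := (d.+1%:R * (2 * d%:R) `^ s * (4 / e))%R.
have C0 : (0 <= C)%R.
  by rewrite /C mulr_ge0 ?divr_ge0 ?mulr_ge0 ?powR_ge0 ?(ltW e0).
have blk k : (K <= k)%N -> (block_length k `^ s *+ block_size k <= C * z ^+ k)%R.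
  move=> Kk; rewrite -[leLHS]mulr_natr block_length_powR /block_size.
  rewrite (natrM _ (2 ^ _)%N) (natrM _ d.+1) natrX.
  have x0 : (0 <= (p k)%:R :> R)%R by [].
  have kx : (k%:R <= (p k)%:R :> R)%R.
    by rewrite ler_nat (leq_trans (leq_full_start k))// full_start_le_end.
  have dq : (d%:R * (q k)%:R <= e / 2 * (p k)%:R)%R.
    rewrite full_endE natrM mulrA ler_wpM2r//.
    have : (d%:R / e <= K%:R)%R := ltW (truncnS_gt _).
    rewrite ler_pdivrMr// => dK; apply: (le_trans dK).
    have : (K%:R <= k%:R :> R)%R by rewrite ler_nat.
    rewrite -[(2 * k).+1%:R]natr1 natrM; nra.
  have -> : (z ^+ k = 2 `^ (- (e / 4) * k%:R))%R by rewrite powRrM powR_mulrn// ltW.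
  have h1 : (2 ^+ (d * a k) <= 2 `^ (beta * d%:R * (p k)%:R + d%:R * (q k)%:R) :> R)%R.
    rewrite -powR_mulrn// ler_powR ?ler1n// natrM.
    have := @hit_start_le_sum R beta beta01 k; rewrite -(ler_pM2l dR); lra.
  have h2 : ((p k)%:R <= 4 / e * 2 `^ (e / 4 * (p k)%:R))%R.
    rewrite -ler_pdivrMl ?divr_gt0// invf_div; exact: powR2_ge.
  apply: (@le_trans _ _ ((2 * d%:R) `^ s * 2 `^ (- (s * (p k)%:R)) *
     (2 `^ (beta * d%:R * (p k)%:R + d%:R * (q k)%:R) *
      (d.+1%:R * (4 / e * 2 `^ (e / 4 * (p k)%:R)))))%R).
    rewrite ler_wpM2l ?mulr_ge0 ?powR_ge0// ler_pM ?exprn_ge0 ?mulr_ge0//.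
    by rewrite ler_wpM2l.
  rewrite (_ : (_ * _ = C * (2 `^ (- (s * (p k)%:R)) *
     2 `^ (beta * d%:R * (p k)%:R + d%:R * (q k)%:R) * 2 `^ (e / 4 * (p k)%:R)))%R);
    last by rewrite /C; ring.
  rewrite -!powRD ?pnatr_eq0 ?implybT// ler_wpM2l// ler_powR ?ler1n//.
  have : (e / 4 * k%:R <= e / 4 * (p k)%:R)%R by rewrite ler_wpM2l// divr_ge0// ltW.
  rewrite /e in dq *; lra.
pose M : R := (\sum_(0 <= k < K) block_length k `^ s *+ block_size k + C / (1 - z))%R.
apply: (@le_lt_trans _ _ M%:E); last exact: ltry.
apply: lime_le; first by apply: is_cvg_nneseries => n _ _; rewrite lee_fin powR_ge0.
apply: nearW => n.
apply: (@le_trans _ _ (\sum_(0 <= n < block_start block_size (K + n)) (radii n `^ s)%:E)).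
  have nb : (n <= block_start block_size (K + n))%N.
    apply: leq_trans (leq_block_start block_size_gt0 _); exact: leq_addl.
  rewrite [leRHS](@big_cat_nat _ _ _ n)//= leeDl//.
  by apply: sume_ge0 => j _; rewrite lee_fin powR_ge0.
rewrite sumEFin lee_fin (block_sum block_size_gt0 (fun k => block_length k `^ s)%R).
rewrite (@big_cat_nat _ _ _ K)//= ?leq_addr// /M lerD2l.
apply: (@le_trans _ _ (\sum_(K <= k < K + n) C * z ^+ k)%R).
  by apply: ler_sum_nat => k /andP[Kk _]; exact: blk.
apply: (@le_trans _ _ (\sum_(0 <= k < K + n) C * z ^+ k)%R).
  rewrite [leRHS](@big_cat_nat _ _ _ K)//= ?leq_addr// lerDr.
  by apply: sumr_ge0 => k _; rewrite mulr_ge0// exprn_ge0// ltW.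
rewrite -mulr_sumr ler_wpM2l// -[leRHS]mul1r ler_pdivlMr ?subr_gt0//.
by rewrite big_mkord -opprB mulrN mulrC -subrX1 opprB gerBl exprn_ge0// ltW.
Qed.

Lemma covering_exponent_radii : covering_exponent d radii = (beta * d%:R)%R.
Proof.
have /andP[b0 b1] := beta01.
have mem : [set s : R | (0 <= s <= d%:R)%R /\
    \sum_(0 <= n <oo) (radii n `^ s)%:E = +oo] (beta * d%:R)%R.
  split; last exact: radii_series_pinfty.
  by rewrite mulr_ge0//= ler_piMl.
rewrite /covering_exponent; apply/eqP; rewrite eq_le; apply/andP; split.
  apply: ge_sup; first by eexists; exact: mem.
  move=> s [_ soo]; rewrite leNgt; apply/negP => /radii_series_lty.
  by rewrite soo ltxx.
by apply: ub_le_sup => //; exists d%:R => s [/andP[]].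
Qed.

End radii.

(** * Random points hit every dyadic cube *)

Lemma one_sub_inv_exp_le (R : realType) (M K : nat) : (0 < M)%N ->
  (1 - M%:R^-1) ^+ (M * K) <= (2 ^+ K)^-1 :> R.
Proof.
move=> M0; have MR : 0 < M%:R :> R by rewrite ltr0n.
have x0 : 0 <= 1 - M%:R^-1 :> R by rewrite subr_ge0 invf_le1// ler1n.
rewrite exprM -exprVn; apply: lerXn2r; rewrite ?nnegrE ?exprn_ge0//.
apply: (@le_trans _ _ (expR (- M%:R^-1) ^+ M)).
  by apply: lerXn2r; rewrite ?nnegrE ?expR_ge0// expR_ge1Dx.
rewrite -expRM_natr mulNr mulVf ?gt_eqF// expRN lef_pV2 ?posrE ?expR_gt0//.
by apply: (le_trans _ (expR_ge1Dx 1)); rewrite le_eqVlt; apply/orP; left; apply/eqP; ring.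
Qed.

Section random_hits.
Context {R : realType} {d : nat} {dO : measure_display}
  {Omega : measurableType dO} (P : probability Omega R)
  (xi : nat -> {RV P >-> torus R d}).
Hypothesis xi_iid : iid_uniform xi.
Local Open Scope ereal_scope.

Definition miss (m n g : nat) (c : code d) : set Omega :=
  \bigcap_(j in [set` [fset j in index_iota m n]%fset]) (xi j @^-1` ~` ocube g c).

Lemma miss_measurable m n g (c : code d) : (forall i, c i < 2 ^ g)%N ->
  measurable (miss m n g c).
Proof.
move=> cg; apply: fin_bigcap_measurable => [|j _]; first exact: finite_fset.
rewrite -[X in measurable X]setTI; apply: measurable_funPT => //.
by apply: measurableC; exact: ocube_measurable.
Qed.

Lemma probability_miss m n g (c : code d) : (forall i, c i < 2 ^ g)%N ->
  P (miss m n g c) <= ((1 - (2 ^ (d * g))%N%:R^-1) ^+ (n - m))%:E.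
Proof.
move=> cg; have mQ := ocube_measurable cg; have [indep unif] := xi_iid.
rewrite /miss (indep _ (fun=> ~` ocube g c)) => [|j _]; last exact: measurableC.
set x : R := (1 - _)%R.
have x0 : (0 <= x)%R.
  by rewrite subr_ge0 invf_le1 ?ltr0n ?expn_gt0// ler1n expn_gt0.
have Px j : P (xi j @^-1` ~` ocube g c) <= x%:E.
  rewrite -[leLHS]/(distribution P (xi j) (~` ocube g c)) unif; last exact: measurableC.
  rewrite probability_setC// /x EFinB leeB// natrX mulnC.
  exact: lebesgue_torus_ocube.
have -> : (n - m)%N = #|` [fset j in index_iota m n]%fset|.
  by rewrite card_fseq undup_id ?iota_uniq// size_iota.
elim: (enum_fset _) => [|j s ih]; first by rewrite big_nil expr0.
rewrite big_cons exprS EFinM lee_pmul//.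
by apply: prode_ge0 => k.
Qed.

Variables (g T K : nat -> nat).
Hypothesis TK : forall k, (T k.+1 - T k = 2 ^ (d * g k) * K k)%N.
Hypothesis gK : forall k, (d * g k + k <= K k)%N.

Definition some_miss k : set Omega :=
  \big[setU/set0]_(c : {ffun 'I_d -> 'I_(2 ^ g k)})
    miss (T k) (T k.+1) (g k) [ffun i => val (c i)].

Let code_lt k (c : {ffun 'I_d -> 'I_(2 ^ g k)}) i :
  ([ffun i => val (c i)] i < 2 ^ g k)%N.
Proof. by rewrite ffunE; exact: ltn_ord. Qed.

Lemma some_miss_measurable k : measurable (some_miss k).
Proof.
apply: bigsetU_measurable => c _.
by apply: miss_measurable => i; exact: code_lt.
Qed.

Lemma probability_some_miss k : P (some_miss k) <= ((2 ^+ k)^-1)%:E.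
Proof.
have M0 : (0 < 2 ^ (d * g k))%N by rewrite expn_gt0.
pose m := fun c : {ffun 'I_d -> 'I_(2 ^ g k)} =>
  miss (T k) (T k.+1) (g k) [ffun i => val (c i)].
have mm c : measurable (m c) by apply: miss_measurable => i; exact: code_lt.
apply: (@le_trans _ _ (\sum_(c : {ffun 'I_d -> 'I_(2 ^ g k)}) P (m c))).
  suff [] : measurable (some_miss k) /\ P (some_miss k) <= \sum_c P (m c) by [].
  rewrite /some_miss; apply: (big_ind2 (fun A x => measurable A /\ P A <= x)).
  - by rewrite measure0.
  - move=> A x B y [mA Ax] [mB By]; split; first exact: measurableU.
    by apply: le_trans (measureU2 _ mA mB) _; exact: leeD.
  - by move=> c _; split; [exact: mm|exact: lexx].
apply: (@le_trans _ _ (\sum_(c : {ffun 'I_d -> 'I_(2 ^ g k)})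
    ((2 ^+ K k)^-1)%:E)).
  apply: lee_sum => c _; apply: (le_trans (probability_miss _ _ _)).
    by move=> i; exact: code_lt.
  by rewrite TK lee_fin; exact: one_sub_inv_exp_le.
rewrite sumEFin lee_fin sumr_const card_ffun !card_ord -expnM mulnC.
rewrite -[leLHS]mulr_natl natrX ler_pdivrMr ?exp2_gt0// ler_pdivlMl ?exp2_gt0//.
by rewrite -exprD ler_weXn2l ?ler1n// addnC.
Qed.

(** By the Borel-Cantelli lemma, since the probabilities of missing a cube in
    the [k]-th block are summable. *)
Lemma almost_surely_hit : {ae P, forall omega, exists k0, forall k, (k0 <= k)%N ->
  forall c : code d, (forall i, c i < 2 ^ g k)%N ->
  exists2 n, (T k <= n < T k.+1)%N & ocube (g k) c (xi n omega)}.
Proof.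
exists (lim_sup_set some_miss); split.
- apply: bigcapT_measurable => k; apply: bigcup_measurable => j _.
  exact: some_miss_measurable.
- apply: lim_sup_set_cvg0; first exact: some_miss_measurable.
  apply: (@le_lt_trans _ _ (\sum_(0 <= k <oo) ((2 ^+ k)^-1)%:E)).
    apply: lee_nneseries => [k _ _|k _]; first by [].
    exact: probability_some_miss.
  apply: (@le_lt_trans _ _ 2%:E); last exact: ltry.
  rewrite (eq_eseriesr (g := fun k => (2 / (2 ^ k.+1)%:R)%:E)) => [|k _].
    exact: epsilon_trick0.
  by rewrite natrX exprS invfM mulrA divff// mul1r.
- move=> omega /= nhit k _; apply: contrapT => nmiss; apply: nhit.
  exists k => j kj c cg; apply: contrapT => nj; apply: nmiss; exists j => //=.
  rewrite /some_miss (bigD1 [ffun i => Ordinal (cg i)])//=; left=> n /=.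
  rewrite in_fset mem_index_iota => nT.
  rewrite (_ : [ffun i => _] = c); last by apply/ffunP => i; rewrite !ffunE.
  by move=> nc; apply: nj; exists n.
Qed.

End random_hits.

(** * The trees inside the random covering set *)

Section hitting_tree.
Context {R : realType} {d : nat}.
Variables (tau beta : R).
Hypotheses (tau01 : 0 <= tau <= 1) (beta01 : 0 <= beta <= 1).
Local Notation p := full_end.
Local Notation a := (hit_start beta).
Variable sel : nat -> code d -> code d.
Hypothesis selE : forall k c i, (sel k c i %/ 2 ^ (p k - a k) = c i)%N.

(** Dropping the last [n - a k] digits of the current cube recovers its ancestor
    of generation [a k], which determines the cube [sel k] to aim for. *)
Definition hit_digit n (c : code d) (i : 'I_d) : bool :=
  let k := xget 0%N [set k | (a k <= n < p k)%N] in
  in_hit beta n &&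
  odd (sel k [ffun j => c j %/ 2 ^ (n - a k)]%N i %/ 2 ^ (p k - n.+1)).

Local Notation path := (@tree_path R d (unhit_free tau beta) hit_digit).

Lemma tree_path_hit u k : path u (p k) = sel k (path u (a k)).
Proof.
have ap := @hit_start_le R beta beta01 k.
suff h m : (a k + m <= p k)%N -> forall i,
    path u (a k + m) i = (sel k (path u (a k)) i %/ 2 ^ (p k - (a k + m)))%N.
  apply/ffunP => i; have := h (p k - a k)%N.
  by rewrite subnKC// => ->; rewrite ?subnn ?divn1.
elim: m => [_ i|m ih mp i]; first by rewrite addn0 selE.
rewrite addnS in mp *; set n := (a k + m)%N in ih mp *.
have an : (a k <= n)%N by rewrite leq_addr.
have kn : (full_start k <= n < full_start k.+1)%N.
  rewrite (leq_trans (start_le_hit beta k))//=.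
  by rewrite (leq_trans mp)// full_end_le_start.
have inn : in_hit beta n by rewrite (in_hit_full beta kn) an mp.
have nfree : unhit_free tau beta n = false by rewrite /unhit_free inn andbF.
rewrite tree_pathS nfree /hit_digit inn/= -/hit_digit.
have -> : xget 0%N [set k | (a k <= n < p k)%N] = k.
  apply: xget_unique; first by rewrite /= an mp.
  move=> j jn; apply: (block_unique _ kn).
  by have := start_le_hit beta j; move: jn => /=; lia.
have -> : [ffun j => path u n j %/ 2 ^ (n - a k)]%N = path u (a k).
  apply/ffunP => j; rewrite ffunE.
  rewrite [RHS](dyadic_div (c := path u) _ (a k) (n - a k)) ?subnK//.
  by move=> *; exact: tree_path_half.
rewrite (ih (ltnW mp)) (_ : p k - n = (p k - n.+1).+1)%N; last by lia.
by rewrite expnSr divnMA divn2 addnC odd_double_half.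
Qed.

End hitting_tree.

Section hitting_points.
Context {R : realType} {d : nat}.

Lemma truncn_div (x : R) m : 0 <= x ->
  (Num.truncn (2 ^+ m * x) %/ 2 ^ m = Num.truncn x)%N.
Proof.
move=> x0; elim: m => [|m ih]; first by rewrite expr0 mul1r expn0 divn1.
rewrite expnS divnMA divn2 exprS -mulrA truncn_half//.
by rewrite mulr_ge0// exprn_ge0.
Qed.

(** This is what makes a ball of radius [d * 2 ^- n] contain the whole cube of
    generation [n] around its centre. *)
Lemma tree_point_same_cube (free : pred nat) (h : nat -> code d -> 'I_d -> bool)
    (u : R) n (x : torus R d) :
  (forall i, tree_path free h u n i = Num.truncn (2 ^+ n * tcoord x i)) ->
  mdist x (tree_point free h u) <= d%:R / 2 ^+ n.
Proof.
move=> ux; rewrite -{1}(tproj_tcoord x); apply: mdist_tproj_le => i.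
have z0 := @exp2_gt0 R n.
have x0 : 0 <= 2 ^+ n * tcoord x i.
  by rewrite mulr_ge0 ?(ltW z0)//; case/andP: (tcoord_itv x i).
have := truncn_itv x0; rewrite -ux => /andP[k1 k2].
have /andP[k3 k4] := @dyadic_lim_itv R d _ (tree_path_half free h u) n i.
rewrite -(ler_pM2r z0) mulVf ?gt_eqF// -[X in _ * X](gtr0_norm z0) -normrM.
move: k2 k4; set c := tree_path _ _ _ _ _.
rewrite -[c.+1%:R]natr1 => k2 k4.
by rewrite ler_norml mulrBl; apply/andP; split; lra.
Qed.

Hypothesis d1 : (1 <= d)%N.
Variables (tau beta : R).
Hypotheses (tau01 : 0 <= tau <= 1) (beta01 : 0 <= beta <= 1).
Local Notation p := full_end.
Local Notation a := (hit_start beta).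
Local Notation F := (@digit_set R d (digit_free tau)).
Local Notation T := (block_start (@block_size R d beta)).
Local Notation l := (@radii R d beta).

Lemma hausdorff_dim_tree (h : nat -> code d -> 'I_d -> bool) (A : set (torus R d)) :
  (forall u, 0 <= u < 1 -> A (tree_point (unhit_free tau beta) h u)) ->
  ((d%:R * Num.min beta tau)%:E <= hausdorff_dim A)%E.
Proof.
move=> Au; have dR : 0 < d%:R :> R by rewrite ltr0n.
apply: hausdorff_dim_ge => s /andP[s0 sd].
have [|C rankC] := @unhit_free_rank_ge R tau beta tau01 beta01 (s / d%:R).
  by rewrite divr_ge0 ?ltr_pdivrMr// 1?mulrC// ltW.
apply: (@hausdorff_measure_tree R d _ h s (d%:R * C) s0 _ A Au) => n.
rewrite natrM; have := rankC n; rewrite -(ler_pM2l dR) mulrBr.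
by rewrite mulrA [d%:R * (s / _)]mulrC divfK ?gt_eqF.
Qed.

(** Each cube of generation [a k] contains the centre of a ball of the [k]-th
    block, and this ball contains the cube of generation [p k] around its
    centre. Prescribing the digits that lead to this smaller cube yields a tree
    in the covering set. The prescribed positions are free for [F], so that the
    tree also stays in [F]. *)
Lemma hausdorff_dim_hit (x : nat -> torus R d) :
  (exists k0, forall k, (k0 <= k)%N ->
    forall c : code d, (forall i, c i < 2 ^ a k)%N ->
    exists2 n, (T k <= n < T k.+1)%N & ocube (a k) c (x n)) ->
  ((d%:R * Num.min beta tau)%:E <= hausdorff_dim (covering_set l x `&` F))%E.
Proof.
move=> [k0 hit].
have /choice[sel1 /choice[sel2 selP]] : forall kc : nat * code d,
    exists (c' : code d) (n : nat),
      (forall i, c' i %/ 2 ^ (p kc.1 - a kc.1) = kc.2 i)%N /\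
      ((k0 <= kc.1)%N -> (forall i, kc.2 i < 2 ^ a kc.1)%N ->
       (T kc.1 <= n < T kc.1.+1)%N /\
       forall i, c' i = Num.truncn (2 ^+ p kc.1 * tcoord (x n) i)).
  move=> [k c] /=.
  have [[k0k cs]|nk] := pselect ((k0 <= k)%N /\ forall i, (c i < 2 ^ a k)%N); last first.
    (* No ball is available: any descendant of [c] will do. *)
    exists [ffun i => c i * 2 ^ (p k - a k)]%N, 0%N; split=> [i|*].
      by rewrite ffunE mulnK// expn_gt0.
    by exfalso; exact: nk.
  have [n nT cn] := hit k k0k c cs.
  exists [ffun i => Num.truncn (2 ^+ p k * tcoord (x n) i)], n.
  split=> [i|_ _]; last by split => // i; rewrite ffunE.
  have x0 : 0 <= 2 ^+ a k * tcoord (x n) i.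
    by rewrite mulr_ge0 ?exprn_ge0//; case/andP: (tcoord_itv (x n) i).
  rewrite ffunE -[in LHS](subnK (hit_start_le beta01 k)) exprD -mulrA.
  rewrite addnK truncn_div//; apply: truncn_def.
  by have /andP[/ltW -> ->] := cn i.
pose sel k c := sel1 (k, c).
have selE k c i : (sel k c i %/ 2 ^ (p k - a k) = c i)%N.
  by have [h _] := selP (k, c); exact: h.
apply: (@hausdorff_dim_tree (hit_digit beta sel)) => u u01; split; last first.
  apply: tree_point_digit_set => [m /andP[]//|m c i].
  rewrite /hit_digit => /andP[/asboolP[k /andP[km mk]] _].
  apply/orP; left; apply/asboolP; exists k.
  by rewrite mk (leq_trans (start_le_hit beta k)).
move=> N _; pose k := maxn k0 N.
pose c := tree_path (unhit_free tau beta) (hit_digit beta sel) u (a k).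
have [_] := selP (k, c); case=> /=.
- exact: leq_maxl.
- by move=> i; exact: tree_path_lt.
move=> nT nc; exists (sel2 (k, c)).
  rewrite /= (leq_trans _ (proj1 (andP nT)))//.
  by rewrite (leq_trans _ (leq_block_start (@block_size_gt0 R d beta) k))// leq_maxr.
rewrite /cball/= /radii (block_eq _ nT) /block_length mulrAC mulfV// mul1r.
by apply: tree_point_same_cube => i; rewrite tree_path_hit.
Qed.

(** Used with [y k] a factorial and [c] the gap to the expected dimension. *)
Lemma unbounded_gap (c : R) (y : nat -> nat) (M : R) N : 0 < c ->
  (forall k, (k <= y k)%N) ->
  exists2 k, (N <= k)%N & M <= (y k)%:R * (c * k%:R - d%:R).
Proof.
move=> c0 ky; pose K := (Num.truncn ((d%:R + 1) / c)).+1.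
pose L := (Num.truncn `|M|).+1.
exists (maxn N (maxn K L)); first exact: leq_maxl.
set k := maxn _ _.
have kK : K%:R <= k%:R :> R by rewrite ler_nat leq_max leq_maxl orbT.
have kL : L%:R <= k%:R :> R by rewrite ler_nat leq_max leq_maxr orbT.
have : (d%:R + 1) / c < K%:R := truncnS_gt _.
rewrite ltr_pdivrMr// => Kc; have ML : `|M| < L%:R := truncnS_gt _.
have yk : k%:R <= (y k)%:R :> R by rewrite ler_nat.
have : K%:R * c <= k%:R * c by rewrite ler_pM2r.
move=> Kk; apply: (le_trans (ler_norm M)).
apply: (@le_trans _ _ ((y k)%:R * 1)); last by rewrite ler_wpM2l//; lra.
lra.
Qed.

Lemma digit_set_hausdorff_dim_le : (hausdorff_dim F <= (d%:R * tau)%:E)%E.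
Proof.
have /andP[t0 t1] := tau01.
apply: hausdorff_dim_le => [|s ts]; first by rewrite mulr_ge0.
apply: hausdorff_measure_digit_set => [|M N].
  by rewrite ltW// (le_lt_trans _ ts)// mulr_ge0.
have c0 : 0 < s - d%:R * tau by rewrite subr_gt0.
have [k Nk Mk] := @unbounded_gap _ p M N c0
  (fun k => leq_trans (leq_full_start k) (full_start_le_end k)).
exists (full_start k.+1).
  by rewrite (leq_trans Nk)// (leq_trans (leqnSn k))// leq_full_start.
apply: (le_trans Mk); have := @digit_free_rank_start R tau tau01 k.
rewrite natrM -(@ler_pM2l _ d%:R) ?ltr0n//.
rewrite full_startS natrM -[(2 * k).+2%:R]natr1 -[(2 * k).+1%:R]natr1 natrM.
have : 0 <= (p k)%:R :> R by [].
have : 0 <= k%:R * ((s - d%:R * tau) * (p k)%:R) by rewrite !mulr_ge0// ltW.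
nra.
Qed.

Lemma digit_set_packing_dim_ge : (d%:R%:E <= packing_dim F)%E.
Proof.
apply: le_ereal_inf_tmp => _ [s [s0 sF] <-]; rewrite lee_fin leNgt.
apply/negP => sd; have c0 : 0 < d%:R - s by rewrite subr_gt0.
suff : packing_measure s F = +oo%E by rewrite sF.
apply: (@packing_measure_tree R d (digit_free tau) (fun _ _ _ => false)).
  move=> M N; have [k Nk Mk] := @unbounded_gap _ full_start M N c0 leq_full_start.
  exists (p k).
    rewrite (leq_trans Nk)// (leq_trans (leq_full_start k))//.
    exact: full_start_le_end.
  apply: (le_trans Mk); have := @digit_free_rank_end R tau k.
  rewrite natrM -(@ler_pM2l _ d%:R) ?ltr0n// full_endE natrM -[(2 * k).+1%:R]natr1 natrM.
  have : 0 <= k%:R * ((d%:R - s) * (full_start k)%:R) by rewrite !mulr_ge0// ltW.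
  have : 0 <= (d%:R - s) * (full_start k)%:R by rewrite !mulr_ge0// ltW.
  nra.
by move=> u _; exact: tree_point_digit_set.
Qed.

Lemma covering_set_dim_le (x : nat -> torus R d) :
  (hausdorff_dim (covering_set l x) <= (beta * d%:R)%:E)%E.
Proof.
have /andP[b0 b1] := beta01.
apply: hausdorff_dim_le => [|s bs]; first by rewrite mulr_ge0.
apply: hausdorff_measure_limsup => [|n|].
- by apply: le_lt_trans bs; rewrite mulr_ge0.
- by rewrite divr_ge0// ltW// radii_gt0.
- under eq_eseriesr do rewrite mulrC divfK//.
  exact: radii_series_lty.
Qed.

End hitting_points.

(** * Dimension of the random intersection *)

Unset Implicit Arguments.

Theorem proposition1p4 (R : realType) (d : nat) (hd : (1 <= d)%N) :
  (forall alpha t : R, 0 <= alpha <= d%:R -> 0 <= t <= d%:R ->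
    exists (l : nat -> R) (F : set (torus R d)),
      [/\ (forall n, 0 < l n) /\ {homo l : m n / (m <= n)%N >-> n <= m},
          covering_exponent d l = alpha,
          closed F,
          hausdorff_dim F = t%:E /\ packing_dim F = d%:R%:E &
          forall (dO : measure_display) (Omega : measurableType dO)
            (P : probability Omega R) (xi : nat -> {RV P >-> torus R d}),
            iid_uniform xi ->
            {ae P, forall omega,
              hausdorff_dim (covering_set l (xi ^~ omega) `&` F) =
              (Num.min alpha t)%:E}])
  /\
  (exists (alpha t : R) (l : nat -> R) (F : set (torus R d)),
      [/\ (0 <= alpha <= d%:R /\ 0 <= t <= d%:R) /\
          ((forall n, 0 < l n) /\ {homo l : m n / (m <= n)%N >-> n <= m}),
          covering_exponent d l = alpha,
          closed F,
          hausdorff_dim F = t%:E /\ packing_dim F = d%:R%:E &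
          forall (dO : measure_display) (Omega : measurableType dO)
            (P : probability Omega R) (xi : nat -> {RV P >-> torus R d}),
            iid_uniform xi ->
            {ae P, forall omega,
              hausdorff_dim (covering_set l (xi ^~ omega) `&` F) =
              (Num.min alpha t)%:E /\
              (hausdorff_dim F + alpha%:E - d%:R%:E
                 < hausdorff_dim (covering_set l (xi ^~ omega) `&` F)
                 < packing_dim F + alpha%:E - d%:R%:E)%E}]).
Proof.
set part1 := (X in X /\ _).
have main : part1.
  move=> alpha t /andP[al0 ald] /andP[t0 td].
  have dR : 0 < d%:R :> R by rewrite ltr0n.
  pose beta := alpha / d%:R; pose tau := t / d%:R.
  have beta01 : 0 <= beta <= 1 by rewrite divr_ge0//= ler_pdivrMr// mul1r.
  have tau01 : 0 <= tau <= 1 by rewrite divr_ge0//= ler_pdivrMr// mul1r.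
  have alE : beta * d%:R = alpha by rewrite divfK ?gt_eqF.
  have tE : d%:R * tau = t by rewrite mulrC divfK ?gt_eqF.
  pose F : set (torus R d) := digit_set (digit_free tau).
  pose l := @radii R d beta.
  have dimF : hausdorff_dim F = t%:E.
    apply/eqP; rewrite eq_le -tE digit_set_hausdorff_dim_le//=.
    (* With [beta = 1] no digit is prescribed and [min 1 tau = tau]. *)
    have one01 : (0 <= 1 :> R) && (1 <= 1 :> R) by rewrite ler01 lexx.
    have -> : tau = Num.min 1 tau.
      by apply/esym/min_idPr; case/andP: tau01.
    apply: (@hausdorff_dim_tree R d hd tau 1 tau01 one01 (fun _ _ _ => false)).
    by move=> u _; apply: tree_point_digit_set => // m /andP[].
  exists l, F; split.
  - by split; [exact: radii_gt0|exact: radii_homo].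
  - by rewrite -alE; exact: covering_exponent_radii.
  - exact: digit_set_closed.
  - split=> //; apply/eqP; rewrite eq_le packing_dim_le//=.
    exact: digit_set_packing_dim_ge.
  move=> dO Omega P xi xi_iid.
  have hit := @almost_surely_hit R d dO Omega P xi xi_iid (hit_start beta)
    (block_start (@block_size R d beta)) (fun k => d.+1 * full_end k)%N.
  apply: filterS (hit _ _) => [omega|k|k].
  - move=> /(hausdorff_dim_hit hd tau01 beta01) h.
    apply/eqP; rewrite eq_le; apply/andP; split.
      rewrite EFin_min le_min; apply/andP; split.
        rewrite -alE; apply: le_trans (covering_set_dim_le hd beta01 (xi ^~ omega)).
        by apply: le_hausdorff_dim; exact: subIsetl.
      by rewrite -dimF; apply: le_hausdorff_dim; exact: subIsetr.
    by move: h; rewrite minr_pMr// ?tE 1?mulrC ?alE// ltW.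
  - by rewrite block_startS addKn.
  - have := hit_start_le beta01 k; have := leq_full_start k.
    have := full_start_le_end k; rewrite mulSn; nia.
split => //.
have dR : 0 < d%:R :> R by rewrite ltr0n.
(* With [t = 0] the two inequalities read [- d / 2 < 0] and [0 < d / 2]. *)
pose alpha : R := d%:R / 2.
have al : 0 <= alpha <= d%:R by rewrite divr_ge0//= ler_pdivrMr// ler_peMr ?ler1n.
have t01 : (0 <= 0 :> R) && (0 <= d%:R :> R) by rewrite lexx/= ltW.
have [l [F [lP lal closedF [dimF dimP] ae]]] := main alpha 0 al t01.
exists alpha, 0, l, F; split => // dO Omega P xi xi_iid.
apply: filterS (ae dO Omega P xi xi_iid) => omega dimEF; split => //.
rewrite dimEF dimF dimP min_r; last by case/andP: al.
have a0 : 0 < alpha by rewrite divr_gt0.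
by apply/andP; split; rewrite /= lte_fin /alpha; lra.
Qed.
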